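(* Let $f:\mathbb{R}^d\to\mathbb{R}$ be twice differentiable with $\|\nabla f(\mathbf{x})-\nabla f(\mathbf{y})\|\le L_1\|\mathbf{x}-\mathbf{y}\|$ and $\|\nabla^2 f(\mathbf{x})-\nabla^2 f(\mathbf{y})\|_2\le L_2\|\mathbf{x}-\mathbf{y}\|$ for all $\mathbf{x},\mathbf{y}$, where $L_1,L_2>0$. Let $\mathbf{x}_0\in\mathbb{R}^d$ satisfy $f(\mathbf{x}_0)-f(\mathbf{x}_* )\le\Delta<\infty$, where $\mathbf{x}_*$ is a global minimizer of $f$. Let $\epsilon_1>0$, $\epsilon_2\in(0,1)$, $\delta\in(0,1)$. Suppose there exist $M<\infty$ and $\epsilon_3\le\epsilon_2/12$ such that the inexact Hessian $H(\cdot)$ (a symmetric $d\times d$ matrix at each point) satisfies $\|H(\mathbf{x}_j)-\nabla^2 f(\mathbf{x}_j)\|_2\le\epsilon_3$ and $\|H(\mathbf{x}_j)\|_2\le M$ at any point $\mathbf{x}_j\in\mathbb{R}^d$. Then the algorithm iH-NCG-A$(\mathbf{x}_0,\epsilon_1,\epsilon_2,\delta)$ (defined in the context) terminates at some iteration $j_*$ with $$j_*\le1+\max\left(\frac{24L_2^2}{\epsilon_2^3},\frac{2L_1}{\epsilon_1^2}\right)\Delta,$$ satisfying $\|\nabla f(\mathbf{x}_{j_*})\|\le\epsilon_1$ and, with probability at least $1-\delta$, $\lambda_{\min}(\nabla^2 f(\mathbf{x}_{j_*}))\ge-2\max(\epsilon_2,\epsilon_1)$. Furthermore, the $j$-th iteration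 requires time at most $$O\left(T_h\,\frac{\sqrt M}{\max(\epsilon_2,\|\nabla f(\mathbf{x}_j)\|)^{1/2}}\log\left(\frac d{\delta'}\right)\right),\qquad\delta'=\frac{\delta}{1+\max\left(\frac{24L_2^2}{\epsilon_2^3},\frac{2L_1}{\epsilon_1^2}\right)\Delta}.$$
   Context: $\|\cdot\|$ is the Euclidean norm, $\|\cdot\|_2$ the spectral norm, $\lambda_{\min}$ the smallest eigenvalue; $\mathrm{sign}(t)=1$ if $t\ge0$ and $-1$ otherwise. $T_h$ is the runtime of one (inexact) Hessian-vector product. Lanczos subroutine (known). Given a symmetric $H$ with $\|H\|_2\le L$, $\varepsilon>0$ and $\delta\in(0,1)$, using fresh independent randomness it returns a unit vector $\mathbf{v}$ such that with probability at least $1-\delta$, $\lambda_{\min}(H)\ge\mathbf{v}^\top H\mathbf{v}-\varepsilon$. Its cost is taken to be $O(\sqrt L\log(d/\delta)/\sqrt\varepsilon)$ matrix-vector products with $H$ (absolute constant; $d$ assumed large). The time of an iteration is the time of its Lanczos call. iH-NCG step, $(\mathbf{x}^+,\mathbf{v})=\text{iH-NCG}(\mathbf{x},\varepsilon,\delta,\epsilon_2)$: (1) use Lanczos on $H(\mathbf{x})$ to find a unit $\mathbf{v}$ with $\lambda_{\min}(H(\mathbf{x}))\ge\mathbf{v}^\top H(\mathbf{x})\mathbf{v}-\varepsilon$ with probability at least $1-\delta$; (2) if $-\frac{\epsilon_2^2}{2L_2^2}\mathbf{v}^\top H(\mathbf{x})\mathbf{v}-\frac{5\epsilon_2^3}{24L_2^2}>\frac{\|\nabla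 f(\mathbf{x})\|^2}{2L_1}$, set $\mathbf{x}^+=\mathbf{x}-\frac{\epsilon_2}{L_2}\mathrm{sign}(\mathbf{v}^\top\nabla f(\mathbf{x}))\mathbf{v}$; otherwise set $\mathbf{x}^+=\mathbf{x}-\frac1{L_1}\nabla f(\mathbf{x})$; (3) return $(\mathbf{x}^+,\mathbf{v})$. Algorithm iH-NCG-A$(\mathbf{x}_0,\epsilon_1,\epsilon_2,\delta)$: set $\mathbf{x}_1=\mathbf{x}_0$, $\delta'=\delta/\bigl(1+\max(\frac{24L_2^2}{\epsilon_2^3},\frac{2L_1}{\epsilon_1^2})\Delta\bigr)$. For $j=1,2,\dots$: $(\mathbf{x}_{j+1},\mathbf{v}_j)=\text{iH-NCG}(\mathbf{x}_j,\max(\epsilon_2,\|\nabla f(\mathbf{x}_j)\|)/2,\delta',\epsilon_2)$; if $\mathbf{v}_j^\top H(\mathbf{x}_j)\mathbf{v}_j>-\epsilon_2/2$ and $\|\nabla f(\mathbf{x}_j)\|\le\epsilon_1$, terminate and return $\mathbf{x}_j$ (then $j_*=j$).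
   Formalization: The inexact Hessian map H(·) is assumed Borel measurable, and the Lanczos output jointly measurable in matrix, accuracy and random seed; without this the event ''λ_min ≥ −2max(ε₂,ε₁)'' need not be measurable and its probability is undefined. *)

(* Defs.v *)
From HB Require Import structures.
From mathcomp Require Import all_boot all_order all_algebra.
From mathcomp Require Import all_classical all_reals all_analysis.

Set Implicit Arguments.
Unset Strict Implicit.
Unset Printing Implicit Defensive.

Import Order.TTheory GRing.Theory Num.Theory.
Import numFieldNormedType.Exports.

Local Open Scope classical_set_scope.
Local Open Scope ring_scope.

Section LinearAlgebra.
Context {R : realType}.

(* The library's norm on matrices is the sup norm of the entries; it is used
   only for the topology. *)
Definition enorm {d} (u : 'cV[R]_d) : R := Num.sqrt (\sum_i u i 0 ^+ 2).

Definition dotv {d} (u v : 'cV[R]_d) : R := (u^T *m v) 0 0.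

Definition quad {d} (A : 'M[R]_d) (v : 'cV[R]_d) : R := (v^T *m A *m v) 0 0.

(* Largest singular value, as the operator norm induced by [enorm]. *)
Definition spectral_norm {d} (A : 'M[R]_d) : R :=
  sup [set enorm (A *m u) | u in [set u : 'cV[R]_d | enorm u <= 1]].

(* Only meant for symmetric matrices with d > 0, whose real spectrum is finite
   and nonempty, so that the infimum is a minimum. *)
Definition lambda_min {d} (A : 'M[R]_d) : R :=
  inf [set a : R | eigenvalue A a].

(* Unlike [Num.sg], equal to 1 at 0. *)
Definition sign1 (t : R) : R := if 0 <= t then 1 else -1.

End LinearAlgebra.

Section Derivatives.
Context {R : realType} {d : nat}.
Implicit Types (f : 'cV[R]_d -> R) (x : 'cV[R]_d).

Definition grad f x : 'cV[R]_d := \col_i 'D_(delta_mx i 0) f x.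

Definition hess f x : 'M[R]_d :=
  \matrix_(i, j) 'D_(delta_mx j 0) (fun y => grad f y i 0) x.

Definition twice_differentiable f : Prop :=
  (forall x, differentiable f x) /\ (forall x, differentiable (grad f) x).

End Derivatives.

(* Matrices and vectors with their Borel sigma-algebra. *)
Notation borel_mx R m n := (g_sigma_algebraType (@open 'M[R]_(m, n))).

Section Randomness.
Context {R : realType} {dO dS : measure_display}.
Context {Omega : measurableType dO} {S : measurableType dS}.

Definition mutually_independent (P : probability Omega R)
    (xi : nat -> {RV P >-> S}) : Prop :=
  forall (J : seq nat) (A : nat -> set S),
    uniq J -> (forall j, measurable (A j)) ->
    P (\bigcap_(j in [set` J]) (xi j @^-1` A j)) =
    (\prod_(j <- J) P (xi j @^-1` A j))%E.

(* Seed [xi j] is consumed by the j-th subroutine call. *)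
Definition fresh_seeds (mu : probability S R) (P : probability Omega R)
    (xi : nat -> {RV P >-> S}) : Prop :=
  mutually_independent xi /\
  forall j (A : set S), measurable A -> distribution P (xi j) A = mu A.

End Randomness.

Section Lanczos.
Context {R : realType} {d : nat} {dS : measure_display} {S : measurableType dS}.

(* A randomized routine taking a matrix, an accuracy, a failure probability and
   a random seed; [lz_products] counts its matrix-vector products. *)
Record lanczos_routine := LanczosRoutine {
  lz_vec : 'M[R]_d -> R -> R -> S -> 'cV[R]_d ;
  lz_products : 'M[R]_d -> R -> R -> S -> nat
}.

Definition lanczos_input (L : R) : set (borel_mx R d d * R) :=
  [set p | [/\ (p.1 : 'M[R]_d)^T = p.1, spectral_norm p.1 <= L & 0 < p.2]].

(* [C] is the constant of the O(.) bound on the number of products, [L] the norm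
   bound on the input matrices, [mu] the law of one seed. *)
Record lanczos_spec (C L : R) (mu : probability S R) (lz : lanczos_routine) :
    Prop := {
  lz_measurable : forall delta : R, 0 < delta < 1 ->
    measurable_fun (lanczos_input L `*` [set: S])
      (fun q : (borel_mx R d d * R) * S =>
         lz_vec lz q.1.1 q.1.2 delta q.2 : borel_mx R d 1) ;
  lz_unit : forall (A : 'M[R]_d) (eps delta : R) (s : S),
    lanczos_input L (A, eps) -> 0 < delta < 1 ->
    enorm (lz_vec lz A eps delta s) = 1 ;
  lz_correct : forall (A : 'M[R]_d) (eps delta : R),
    lanczos_input L (A, eps) -> 0 < delta < 1 ->
    ((1 - delta)%:E <=
     mu [set s | (quad A (lz_vec lz A eps delta s) - eps <= lambda_min A)%R])%E ;
  lz_cost : forall (A : 'M[R]_d) (eps delta : R) (s : S),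
    lanczos_input L (A, eps) -> 0 < delta < 1 ->
    (lz_products lz A eps delta s)%:R <=
      C * (Num.sqrt L * ln (d%:R / delta) / Num.sqrt eps)
}.

End Lanczos.
Arguments lanczos_routine R d {dS} S.

Section Algorithm.
Context {R : realType} {d : nat} {dS : measure_display} {S : measurableType dS}.
Variables (f : 'cV[R]_d -> R) (H : 'cV[R]_d -> 'M[R]_d).
Variable lz : lanczos_routine R d S.
Variables (L1 L2 : R).

Definition ih_ncg (x : 'cV[R]_d) (eps delta eps2 : R) (s : S) :
    'cV[R]_d * 'cV[R]_d :=
  let g := grad f x in
  let v := lz_vec lz (H x) eps delta s in
  let xplus :=
    if enorm g ^+ 2 / (2 * L1) <
       - (eps2 ^+ 2 / (2 * L2 ^+ 2)) * quad (H x) v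
       - 5 * eps2 ^+ 3 / (24 * L2 ^+ 2)
    then x - (eps2 / L2 * sign1 (dotv v g)) *: v
    else x - L1^-1 *: g in
  (xplus, v).

Definition iter_bound (Delta eps1 eps2 : R) : R :=
  1 + Num.max (24 * L2 ^+ 2 / eps2 ^+ 3) (2 * L1 / eps1 ^+ 2) * Delta.

Variables (Delta : R) (x0 : 'cV[R]_d) (eps1 eps2 delta : R).

Definition delta' : R := delta / iter_bound Delta eps1 eps2.

Definition lanczos_eps (x : 'cV[R]_d) : R :=
  Num.max eps2 (enorm (grad f x)) / 2.

(* A run is determined by the seed sequence [w]. Iterations are numbered from 1
   and the sequence is continued past the stopping time for convenience. *)
Fixpoint iterate (w : nat -> S) (j : nat) : 'cV[R]_d :=
  match j with
  | 0 | 1 => x0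
  | (k.+1 as j').+1 =>
      let x := iterate w j' in
      (ih_ncg x (lanczos_eps x) delta' eps2 (w j')).1
  end.

Definition direction (w : nat -> S) (j : nat) : 'cV[R]_d :=
  let x := iterate w j in
  (ih_ncg x (lanczos_eps x) delta' eps2 (w j)).2.

Definition stop_test (w : nat -> S) (j : nat) : Prop :=
  - (eps2 / 2) < quad (H (iterate w j)) (direction w j) /\
  enorm (grad f (iterate w j)) <= eps1.

Definition executed (w : nat -> S) (j : nat) : Prop :=
  (1 <= j)%N /\ forall i, (1 <= i < j)%N -> ~ stop_test w i.

Definition halts_at (w : nat -> S) (j : nat) : Prop :=
  executed w j /\ stop_test w j.

(* [Th] is the time of one product with the inexact Hessian. *)
Definition iteration_time (Th : R) (w : nat -> S) (j : nat) : R :=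
  let x := iterate w j in
  Th * (lz_products lz (H x) (lanczos_eps x) delta' (w j))%:R.

End Algorithm.

(* Main.v *)
Require Import Defs.
From HB Require Import structures.
From mathcomp Require Import all_boot all_order all_algebra.
From mathcomp Require Import all_classical all_reals all_analysis.
From mathcomp Require Import measurable_realfun ring lra.

Set Implicit Arguments.
Unset Strict Implicit.
Unset Printing Implicit Defensive.

Import Order.TTheory GRing.Theory Num.Theory.
Import numFieldNormedType.Exports.

Local Open Scope classical_set_scope.
Local Open Scope ring_scope.

(** Termination is deterministic. By Taylor's formula (Lipschitz gradient for the
    gradient step, Lipschitz Hessian for the negative curvature step) each of the
    two candidate steps decreases [f] by at least the quantity that the algorithm
    compares, and an iteration that fails the stopping test makes the larger of
    the two at least [min (eps2 ^+ 3 / (24 * L2 ^+ 2)) (eps1 ^+ 2 / (2 * L1))]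
    ([step_decrease]). Since [f] cannot fall by more than [Delta], the number of
    iterations is at most [K] ([executed_le_iter_bound], [run_halts]).

    The curvature guarantee can fail only if the eigenvector routine fails at the
    iteration that stops ([curvature_guarantee]). The point of iteration [j] is a
    measurable function of the earlier seeds, hence independent of the seed of
    iteration [j] ([chain_independent]). By Fubini's theorem the routine
    therefore fails at iteration [j] with probability at most [delta / K]
    ([fresh_seed_bound], [lanczos_failure_le]), and a union bound over the at most
    [K] iterations gives [delta]. The number of iterations is bounded in advance,
    so the union runs over a fixed range although the stopping time is random.

    Two facts support this. For a symmetric matrix, [c <= lambda_min A] is
    equivalent to a bound on the quadratic form ([lambda_min_geP]); it transfers
    curvature from [H] to the Hessian, which is symmetric by Schwarz's theorem
    ([hess_sym]). It also exhibits the sets defined by [lambda_min] as preimages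
    of a closed cone; together with a criterion by entries for maps into spaces of
    matrices ([measurable_fun_mx]) this gives the measurability of all the events
    involved. The time bound is the cost bound of the routine at the accuracy
    that the algorithm requests. *)

(** * Euclidean norm and spectral norm *)

Section EuclideanGeometry.
Context {R : realType} {d : nat}.
Implicit Types (u v w : 'cV[R]_d) (a : R).

Lemma dotvE u v : dotv u v = \sum_i u i 0 * v i 0.
Proof. by rewrite /dotv mxE; apply: eq_bigr => i _; rewrite mxE. Qed.

Lemma dotvC u v : dotv u v = dotv v u.
Proof. by rewrite !dotvE; apply: eq_bigr => i _; rewrite mulrC. Qed.

Lemma dotvDl u v w : dotv (u + v) w = dotv u w + dotv v w.
Proof. by rewrite /dotv linearD mulmxDl mxE. Qed.

Lemma dotvDr u v w : dotv u (v + w) = dotv u v + dotv u w.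
Proof. by rewrite /dotv mulmxDr mxE. Qed.

Lemma dotvZl a u v : dotv (a *: u) v = a * dotv u v.
Proof. by rewrite /dotv linearZ -scalemxAl mxE. Qed.

Lemma dotvZr a u v : dotv u (a *: v) = a * dotv u v.
Proof. by rewrite /dotv -scalemxAr mxE. Qed.

Lemma dotvNl u v : dotv (- u) v = - dotv u v.
Proof. by rewrite -scaleN1r dotvZl mulN1r. Qed.

Lemma dotvNr u v : dotv u (- v) = - dotv u v.
Proof. by rewrite -scaleN1r dotvZr mulN1r. Qed.

Lemma enorm_ge0 u : 0 <= enorm u.
Proof. exact: sqrtr_ge0. Qed.

Lemma sqr_enorm u : enorm u ^+ 2 = dotv u u.
Proof.
rewrite /enorm sqr_sqrtr; last by apply: sumr_ge0 => i _; exact: sqr_ge0.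
by rewrite dotvE; apply: eq_bigr => i _; rewrite expr2.
Qed.

Lemma coord_le_enorm u i : `|u i 0| <= enorm u.
Proof.
rewrite -[leLHS](@ger0_norm _ `|_|)// -sqrtr_sqr /enorm ler_wsqrtr//.
rewrite real_normK ?num_real// (bigD1 i)//= lerDl.
by apply: sumr_ge0 => k _; exact: sqr_ge0.
Qed.

Lemma enorm_eq0 u : enorm u = 0 -> u = 0.
Proof.
move=> u0; apply/matrixP => i j; rewrite ord1 mxE.
by apply/eqP; rewrite -normr_le0 -u0 coord_le_enorm.
Qed.

Lemma enorm0 : enorm (0 : 'cV[R]_d) = 0.
Proof. by apply/eqP; rewrite -sqrf_eq0 sqr_enorm /dotv mulmx0 mxE. Qed.

Lemma enormZ a u : enorm (a *: u) = `|a| * enorm u.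
Proof.
apply/eqP; rewrite -(@eqrXn2 _ 2)// ?mulr_ge0 ?enorm_ge0//.
by rewrite exprMn !sqr_enorm dotvZl dotvZr real_normK ?num_real// mulrA expr2.
Qed.

Lemma enormN u : enorm (- u) = enorm u.
Proof. by rewrite -scaleN1r enormZ normrN1 mul1r. Qed.

(** Cauchy-Schwarz, from expanding the square of
    [enorm v *: u - enorm u *: v]. *)
Lemma dotv_le_enorm u v : `|dotv u v| <= enorm u * enorm v.
Proof.
wlog uv0 : u / 0 <= dotv u v => [hw|].
  case: (leP 0 (dotv u v)) => [/hw//|uv0].
  by rewrite -normrN -dotvNl -(enormN u); apply: hw; rewrite dotvNl; lra.
rewrite ger0_norm//; set p := enorm u; set q := enorm v.
have p0 : 0 <= p by exact: enorm_ge0.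
have q0 : 0 <= q by exact: enorm_ge0.
have [/enorm_eq0 ->|/eqP pn0] := eqVneq p 0.
  by rewrite /dotv trmx0 mul0mx mxE mulr_ge0.
have [/enorm_eq0 ->|/eqP qn0] := eqVneq q 0.
  by rewrite /dotv mulmx0 mxE mulr_ge0.
have pq : 0 < p * q by rewrite mulr_gt0// lt0r; apply/andP; split => //; exact/eqP.
have := sqr_ge0 (enorm (q *: u - p *: v)).
rewrite sqr_enorm !(dotvDl,dotvDr,dotvNl,dotvNr,dotvZl,dotvZr) -!sqr_enorm.
rewrite (dotvC v u) -/p -/q => h.
rewrite -(ler_pM2l pq); nra.
Qed.

Lemma enormD u v : enorm (u + v) <= enorm u + enorm v.
Proof.
rewrite -(@ler_pXn2r _ 2)// ?nnegrE ?addr_ge0 ?enorm_ge0//.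
rewrite sqr_enorm !(dotvDl,dotvDr) -!sqr_enorm (dotvC v u).
have := le_trans (ler_norm _) (dotv_le_enorm u v); nra.
Qed.

End EuclideanGeometry.

Section SpectralNorm.
Context {R : realType} {d : nat}.
Implicit Types (A B : 'M[R]_d) (u v : 'cV[R]_d).

(** The Frobenius norm of [A] serves as [N]. Such a bound makes the supremum that
    defines [spectral_norm] finite; [sup] has a default value otherwise. *)
Lemma enorm_mul_bounded A :
  exists2 N : R, 0 <= N & forall u, enorm (A *m u) <= N * enorm u.
Proof.
exists (enorm (\col_i enorm (row i A)^T)); first exact: enorm_ge0.
move=> u; rewrite -(@ler_pXn2r _ 2)// ?nnegrE ?mulr_ge0 ?enorm_ge0//.
rewrite exprMn [leLHS]sqr_enorm (sqr_enorm (\col_i _)) !dotvE mulr_suml.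
apply: ler_sum => i _; rewrite -expr2 -expr2 mxE -exprMn.
have -> : (A *m u) i 0 = dotv (row i A)^T u.
  by rewrite dotvE mxE; apply: eq_bigr => k _; rewrite !mxE.
rewrite -[_ ^+ 2]real_normK ?num_real//.
by rewrite ler_pXn2r ?nnegrE ?mulr_ge0 ?enorm_ge0// dotv_le_enorm.
Qed.

Lemma has_sup_spectral A :
  has_sup [set enorm (A *m u) | u in [set u : 'cV[R]_d | enorm u <= 1]].
Proof.
split; first by exists (enorm (A *m 0)), 0 => //=; rewrite enorm0.
have [N N0 hN] := enorm_mul_bounded A.
exists N => _ [u /= u1 <-]; apply: le_trans (hN u) _.
by rewrite -[leRHS]mulr1 ler_wpM2l.
Qed.

Lemma spectral_norm_leP A (L : R) :
  spectral_norm A <= L <-> forall u, enorm u <= 1 -> enorm (A *m u) <= L.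
Proof.
split=> [AL u u1|AL].
  apply: le_trans AL; apply: ub_le_sup => /=; last by exists u.
  by have [] := has_sup_spectral A.
apply: ge_sup; first by have [] := has_sup_spectral A.
by move=> _ [u /= u1 <-]; exact: AL.
Qed.

Lemma spectral_norm_ge0 A : 0 <= spectral_norm A.
Proof.
have /spectral_norm_leP/(_ 0) := lexx (spectral_norm A).
by rewrite enorm0 mulmx0 enorm0; apply.
Qed.

Lemma enorm_mul_le A u : enorm (A *m u) <= spectral_norm A * enorm u.
Proof.
have [u0|un0] := eqVneq (enorm u) 0.
  by rewrite u0 (enorm_eq0 u0) mulmx0 enorm0 mulr0.
have ugt0 : 0 < enorm u by rewrite lt_def un0 enorm_ge0.
have /spectral_norm_leP/(_ ((enorm u)^-1 *: u)) := lexx (spectral_norm A).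
rewrite -scalemxAr !enormZ gtr0_norm ?invr_gt0// mulVf// => /(_ (lexx _)).
by rewrite mulrC ler_pdivrMr.
Qed.

Lemma quadE A u : quad A u = dotv u (A *m u).
Proof. by rewrite /quad /dotv mulmxA. Qed.

Lemma quadZ A (a : R) u : quad A (a *: u) = a ^+ 2 * quad A u.
Proof. by rewrite !quadE -scalemxAr dotvZl dotvZr mulrA expr2. Qed.

Lemma quadB A B u : quad (A - B) u = quad A u - quad B u.
Proof. by rewrite !quadE mulmxBl dotvDr dotvNr. Qed.

Lemma dotv_mul_le A u v :
  `|dotv v (A *m u)| <= spectral_norm A * enorm u * enorm v.
Proof.
apply: le_trans (dotv_le_enorm _ _) _.
by rewrite mulrC ler_wpM2r ?enorm_ge0// enorm_mul_le.
Qed.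

Lemma quad_le A u : `|quad A u| <= spectral_norm A * enorm u ^+ 2.
Proof. by rewrite quadE expr2 mulrA dotv_mul_le. Qed.

Lemma enorm_delta (i : 'I_d) : enorm (delta_mx i 0 : 'cV[R]_d) = 1.
Proof.
rewrite /enorm (bigD1 i)//= big1 ?addr0 => [|j ji].
  by rewrite mxE !eqxx/= expr1n sqrtr1.
by rewrite mxE (negbTE ji)/= expr0n.
Qed.

Lemma entry_le_spectral A i j : `|A i j| <= spectral_norm A.
Proof.
have := enorm_mul_le A (delta_mx j 0); rewrite enorm_delta mulr1.
by apply: le_trans; rewrite -colE; have := coord_le_enorm (col j A) i; rewrite mxE.
Qed.

End SpectralNorm.

(** * The smallest eigenvalue as a minimum of the quadratic form *)

Section SmallestEigenvalue.
Context {R : realType} {d : nat}.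
Implicit Types (A B : 'M[R]_d) (u v : 'cV[R]_d).

Lemma eigenvalue_unitmx A (a : R) : eigenvalue A a = (A - a%:M \notin unitmx).
Proof. by rewrite /eigenvalue /eigenspace kermx_eq0 row_free_unit. Qed.

Lemma dotv_sym A u v : A^T = A -> dotv u (A *m v) = dotv v (A *m u).
Proof. by move=> sA; rewrite dotvC /dotv trmx_mul sA mulmxA. Qed.

(** For a positive semidefinite [B] the form controls the image: evaluate it at
    [u - N^-1 *: (B *m u)], one gradient step from [u] for the form. *)
Lemma psd_sqr_le B (N : R) u : B^T = B -> (forall w, 0 <= quad B w) ->
  0 < N -> spectral_norm B <= N -> enorm (B *m u) ^+ 2 <= N * quad B u.
Proof.
move=> sB psdB N0 BN; have := psdB (u - N^-1 *: (B *m u)).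
rewrite !quadE mulmxBr -scalemxAr !(dotvDl,dotvDr,dotvNl,dotvNr,dotvZl,dotvZr).
rewrite (dotv_sym u (B *m u) sB) -sqr_enorm -!quadE => h.
have h1 : quad B (B *m u) <= N * enorm (B *m u) ^+ 2.
  apply: le_trans (ler_norm _) (le_trans (quad_le _ _) _).
  by rewrite ler_wpM2r ?sqr_ge0.
move: h h1; set e := enorm _ ^+ 2; set p := quad B u; set q := quad B _ => h h1.
have h2 : N^-1 * (N^-1 * q) <= N^-1 * e.
  by rewrite ler_pM2l ?invr_gt0// -ler_pdivlMl ?invr_gt0// invrK.
have : N^-1 * e <= p by lra.
by rewrite ler_pdivrMl.
Qed.

(** Courant-Fischer for the smallest eigenvalue. The infimum [m] of the form over
    the unit sphere is an eigenvalue: were [A - m%:M] invertible, [psd_sqr_le]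
    would bound its form from below on the sphere by a positive constant, and
    [m] would not be the infimum. Every eigenvalue is a value of the form on the
    sphere, so [m] is the smallest. *)
Lemma lambda_min_geP A (c : R) : (0 < d)%N -> A^T = A ->
  c <= lambda_min A <-> forall u, c * enorm u ^+ 2 <= quad A u.
Proof.
move=> d0 sA.
pose Q := [set quad A u | u in [set u : 'cV[R]_d | enorm u = 1]].
have Q0 : Q !=set0.
  by exists (quad A (delta_mx (Ordinal d0) 0)), (delta_mx (Ordinal d0) 0) => //=;
    rewrite enorm_delta.
have Qlb : lbound Q (- spectral_norm A).
  move=> _ [u /= u1 <-]; have := quad_le A u.
  by rewrite u1 expr1n mulr1 ler_norml => /andP[].
have hQ : has_inf Q by split => //; exists (- spectral_norm A).
pose m := inf Q.
have mP u : m * enorm u ^+ 2 <= quad A u.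
  have [u0|un0] := eqVneq (enorm u) 0.
    by rewrite u0 (enorm_eq0 u0) /quad mulmx0 mxE expr0n/= mulr0.
  have ugt0 : 0 < enorm u by rewrite lt_def un0 enorm_ge0.
  rewrite -ler_pdivlMr ?exprn_gt0// mulrC -exprVn -quadZ.
  apply: ge_inf; first by exists (- spectral_norm A).
  exists ((enorm u)^-1 *: u) => //=.
  by rewrite enormZ gtr0_norm ?invr_gt0// mulVf.
have quadBm u : quad (A - m%:M) u = quad A u - m * enorm u ^+ 2.
  by rewrite quadB [X in _ - X]quadE mul_scalar_mx dotvZr sqr_enorm.
have mE : eigenvalue A m.
  rewrite eigenvalue_unitmx; apply/negP => uB; set B := A - m%:M in uB.
  have sB : B^T = B by rewrite /B linearB/= sA tr_scalar_mx.
  have psdB w : 0 <= quad B w by rewrite quadBm subr_ge0.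
  (* The summands 1 only serve to make both constants positive. *)
  pose N := spectral_norm B + 1; pose c' := spectral_norm (invmx B) + 1.
  have N0 : 0 < N by have := spectral_norm_ge0 B; rewrite /N; lra.
  have c0 : 0 < c' by have := spectral_norm_ge0 (invmx B); rewrite /c'; lra.
  have BN : spectral_norm B <= N by rewrite /N; lra.
  suff : m + (c' ^+ 2 * N)^-1 <= m.
    by rewrite gerDl leNgt invr_gt0 mulr_gt0// exprn_gt0.
  apply: lb_le_inf => // _ [u /= u1 <-].
  have := psd_sqr_le u sB psdB N0 BN; rewrite quadBm u1 expr1n mulr1 => h1.
  have h2 : 1 <= c' * enorm (B *m u).
    rewrite -{1}u1 -[X in enorm X <= _](mulKmx uB).
    apply: le_trans (enorm_mul_le _ _) _.
    by rewrite ler_wpM2r ?enorm_ge0// /c'; lra.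
  have h3 : 1 <= c' ^+ 2 * (N * (quad A u - m)).
    apply: (@le_trans _ _ ((c' * enorm (B *m u)) ^+ 2)).
      by rewrite exprn_ege1.
    by rewrite exprMn ler_pM2l ?exprn_gt0.
  rewrite -lerBrDl -[leLHS]mulr1 ler_pdivrMl ?mulr_gt0 ?exprn_gt0//.
  by rewrite -mulrA.
have lb_m : lbound [set a : R | eigenvalue A a] m.
  move=> a /= /eigenvalueP[v vA vn0].
  have := mP v^T; rewrite /quad trmxK vA -scalemxAl mxE.
  have -> : (v *m v^T) 0 0 = enorm v^T ^+ 2 by rewrite sqr_enorm /dotv trmxK.
  rewrite ler_pM2r// exprn_gt0// lt_def enorm_ge0 andbT.
  apply/eqP => /enorm_eq0 v0; move/eqP: vn0; apply.
  by rewrite -[v]trmxK v0 trmx0.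
have -> : lambda_min A = m.
  apply/eqP; rewrite eq_le; apply/andP; split.
    by apply: ge_inf => //; exists m.
  by apply: lb_le_inf => //; exists m.
split=> [cm u|cA]; first by apply: le_trans (mP u); rewrite ler_wpM2r ?sqr_ge0.
apply: lb_le_inf => // _ [u /= u1 <-].
by have := cA u; rewrite u1 expr1n mulr1.
Qed.

End SmallestEigenvalue.

(** * Taylor bounds along lines *)

Section Calculus.
Context {R : realType} {d : nat}.
Implicit Types (F : 'cV[R]_d -> R) (x u v : 'cV[R]_d).

Lemma add_subl x u : x + u - x = u.
Proof. by rewrite addrAC subrr add0r. Qed.

Lemma derive_coord F x u : differentiable F x ->
  'D_u F x = \sum_i u i 0 * 'D_(delta_mx i 0) F x.
Proof.
move=> dF; rewrite deriveE// {1}(matrix_sum_delta u) linear_sum.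
apply: eq_bigr => i _; rewrite big_ord1 linearZ/= deriveE//.
Qed.

(** The two difference quotients agree up to rewriting [x + (t + h) *: u], so
    differentiation along a line is one-variable differentiation. *)
Lemma is_derive_line F x u (t : R) : differentiable F (x + t *: u) ->
  is_derive t 1 (fun s : R => F (x + s *: u)) ('D_u F (x + t *: u)).
Proof.
move=> dF; have dFu : derivable F (x + t *: u) u by exact: diff_derivable.
have E : (fun h : R => h^-1 *: (F (x + (h *: 1 + t) *: u) - F (x + t *: u))) =
         (fun h : R => h^-1 *: (F (h *: u + (x + t *: u)) - F (x + t *: u))).
  apply/funext => h; congr (_ *: (F _ - _)).
  by rewrite [h *: 1]mulr1 scalerDl addrCA.
by constructor; rewrite /derivable /derive E.
Qed.

(** Comparison of derivatives, the mean value theorem applied to [phi - p]. It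
    replaces the integral remainders in the Taylor estimates below. *)
Lemma le_increment (phi p dphi dp : R -> R) (b : R) : 0 <= b ->
  (forall t : R, is_derive t 1 phi (dphi t)) ->
  (forall t : R, is_derive t 1 p (dp t)) ->
  (forall t : R, 0 <= t <= b -> dphi t <= dp t) ->
  phi b - phi 0 <= p b - p 0.
Proof.
move=> b0 hphi hp hle.
have hd t : is_derive t (1:R) (phi \- p) (dphi t - dp t) by exact: is_deriveB.
have cont : {within `[0, b], continuous (phi \- p)}.
  apply: continuous_subspaceT => t.
  apply: differentiable_continuous; apply/derivable1_diffP.
  by have [] := hd t.
have [c cb] := MVT_segment b0 (fun t _ => hd t) cont.
rewrite subr0 /= => E.
have : (phi b - p b) - (phi 0 - p 0) <= 0.
  rewrite E mulr_le0_ge0// subr_le0 hle//.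
lra.
Qed.

Lemma increment_approx (phi dphi : R -> R) (c e : R) :
  (forall t : R, is_derive t 1 phi (dphi t)) ->
  (forall t : R, 0 <= t <= 1 -> `|dphi t - c| <= e) ->
  `|phi 1 - phi 0 - c| <= e.
Proof.
move=> hphi he.
have cont : {within `[0, 1], continuous phi}.
  apply: continuous_subspaceT => t.
  apply: differentiable_continuous; apply/derivable1_diffP.
  by have [] := hphi t.
have [t tb ->] := MVT_segment ler01 (fun t _ => hphi t) cont.
by rewrite subr0 mulr1 he//; move: tb; rewrite in_itv.
Qed.

Lemma is_derive_monomial (a : R) n (t : R) :
  is_derive t 1 (fun s : R => a * s ^+ n.+1) (a * (n.+1%:R * t ^+ n)).
Proof.
have := is_derive_poly (a *: 'X^(n.+1)) t.
rewrite derivZ derivXn hornerZ hornerMn hornerXn mulr_natl.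
suff -> : horner (a *: 'X^(n.+1)) = fun s : R => a * s ^+ n.+1 by [].
by apply/funext => s; rewrite hornerZ hornerXn.
Qed.

(** Compares orders of magnitude as [s] tends to 0. *)
Lemma small_multiple_eq0 (a b : R) :
  (forall s, 0 < s -> `|s ^+ 2 * a| <= s ^+ 3 * b) -> a = 0.
Proof.
move=> h; apply/eqP; rewrite -normr_le0; apply/ler_addgt0Pr => e e0.
have b0 : 0 < `|b| + 1 by rewrite ltr_wpDl.
set s := e / (`|b| + 1); have s0 : 0 < s by rewrite divr_gt0.
have := h _ s0; rewrite normrM gtr0_norm ?exprn_gt0// [s ^+ 3]exprSr.
rewrite -(mulrA (s ^+ 2) s b) ler_pM2l ?exprn_gt0// add0r => /le_trans; apply.
rewrite /s mulrAC ler_pdivrMr// ler_pM2l//.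
by rewrite (le_trans (ler_norm b))// lerDl.
Qed.

End Calculus.

Section Taylor.
Context {R : realType} {d : nat} (f : 'cV[R]_d -> R).
Hypothesis f2 : twice_differentiable f.
Implicit Types (x u v : 'cV[R]_d).

Lemma is_derive_grad_line x u (t : R) :
  is_derive t 1 (fun s : R => f (x + s *: u)) (dotv (grad f (x + t *: u)) u).
Proof.
have df y : differentiable f y by case: f2.
apply: is_derive_eq; first exact: is_derive_line.
rewrite derive_coord// dotvE; apply: eq_bigr => i _.
by rewrite mxE mulrC.
Qed.

Lemma differentiable_grad_coord x i : differentiable (fun y => grad f y i 0) x.
Proof.
case: f2 => _ /(_ x) dg.
exact: (differentiable_comp dg (differentiable_coord _ _ _)).
Qed.

Lemma is_derive_dotv_grad_line x u v (t : R) :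
  is_derive t 1 (fun s : R => dotv (grad f (x + s *: u)) v)
    (dotv v (hess f (x + t *: u) *m u)).
Proof.
have D i : is_derive t 1 (v i 0 *: (fun s : R => grad f (x + s *: u) i 0))
    (v i 0 *: 'D_u (fun y => grad f y i 0) (x + t *: u)).
  apply: is_deriveZ.
  by apply: is_derive_line; exact: differentiable_grad_coord.
move: (is_derive_sum D); set F := (X in is_derive _ _ X _).
have -> : F = (fun s : R => dotv (grad f (x + s *: u)) v).
  apply/funext => s; rewrite dotvE /F fct_sumE; apply: eq_bigr => i _.
  by rewrite mulrC.
move=> DS; apply: is_derive_eq.
rewrite dotvE; apply: eq_bigr => i _; congr (_ * _).
rewrite derive_coord; last exact: differentiable_grad_coord.
by rewrite mxE; apply: eq_bigr => j _; rewrite mxE mulrC.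
Qed.

Lemma grad_descent (L1 : R) x u :
  (forall x y, enorm (grad f x - grad f y) <= L1 * enorm (x - y)) ->
  f (x + u) <= f x + dotv (grad f x) u + L1 / 2 * enorm u ^+ 2.
Proof.
move=> gL.
have := @le_increment _ (fun s => f (x + s *: u))
  (fun s => dotv (grad f x) u * s ^+ 1 + (L1 / 2 * enorm u ^+ 2) * s ^+ 2)
  (fun s => dotv (grad f (x + s *: u)) u)
  (fun s => dotv (grad f x) u * (1%:R * s ^+ 0) +
     (L1 / 2 * enorm u ^+ 2) * (2%:R * s ^+ 1)) 1 ler01.
rewrite !scale1r scale0r addr0 => H.
suff : f (x + u) - f x <=
  dotv (grad f x) u * 1 ^+ 1 + L1 / 2 * enorm u ^+ 2 * 1 ^+ 2 -
  (dotv (grad f x) u * 0 ^+ 1 + L1 / 2 * enorm u ^+ 2 * 0 ^+ 2) by lra.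
apply: H => [t|t|t /andP[t0 _]]; first exact: is_derive_grad_line.
  by apply: is_deriveD; exact: is_derive_monomial.
rewrite expr0 expr1 !mulr1.
have := dotv_le_enorm (grad f (x + t *: u) - grad f x) u.
rewrite dotvDl dotvNl => /(le_trans (ler_norm _)).
have := gL (x + t *: u) x; rewrite add_subl enormZ ger0_norm//.
by move=> /(ler_wpM2r (enorm_ge0 u)); lra.
Qed.

Variable L2 : R.
Hypothesis L2_ge0 : 0 <= L2.
Hypothesis hessL :
  forall x y, spectral_norm (hess f x - hess f y) <= L2 * enorm (x - y).

(** First integration of the Lipschitz bound on the Hessian. *)
Lemma grad_line_le x u (t : R) : 0 <= t ->
  dotv (grad f (x + t *: u)) u <=
  dotv (grad f x) u + t * quad (hess f x) u + L2 / 2 * enorm u ^+ 3 * t ^+ 2.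
Proof.
move=> t0.
have := @le_increment _ (fun s => dotv (grad f (x + s *: u)) u)
  (fun s => quad (hess f x) u * s ^+ 1 + (L2 / 2 * enorm u ^+ 3) * s ^+ 2)
  (fun s => quad (hess f (x + s *: u)) u)
  (fun s => quad (hess f x) u * (1%:R * s ^+ 0) +
     (L2 / 2 * enorm u ^+ 3) * (2%:R * s ^+ 1)) t t0.
rewrite scale0r addr0 => H.
suff : dotv (grad f (x + t *: u)) u - dotv (grad f x) u <=
  quad (hess f x) u * t ^+ 1 + L2 / 2 * enorm u ^+ 3 * t ^+ 2 -
  (quad (hess f x) u * 0 ^+ 1 + L2 / 2 * enorm u ^+ 3 * 0 ^+ 2) by lra.
apply: H => [s|s|s /andP[s0 _]].
- by apply: is_derive_eq; [exact: is_derive_dotv_grad_line|rewrite quadE].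
- by apply: is_deriveD; exact: is_derive_monomial.
rewrite expr0 expr1 !mulr1.
have := le_trans (ler_norm _) (quad_le (hess f (x + s *: u) - hess f x) u).
rewrite quadB lerBlDl => /le_trans; apply; rewrite lerD2l.
have := hessL (x + s *: u) x; rewrite add_subl enormZ ger0_norm//.
move=> /(ler_wpM2r (sqr_ge0 (enorm u))) /le_trans; apply.
by rewrite le_eqVlt; apply/orP; left; apply/eqP; field.
Qed.

(** Second integration: it is [grad_line_le] compared with a cubic in [t]. *)
Lemma hess_descent x u :
  f (x + u) <=
  f x + dotv (grad f x) u + quad (hess f x) u / 2 + L2 / 6 * enorm u ^+ 3.
Proof.
have := @le_increment _ (fun s => f (x + s *: u))
  (fun s => dotv (grad f x) u * s ^+ 1 + quad (hess f x) u / 2 * s ^+ 2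
     + (L2 / 6 * enorm u ^+ 3) * s ^+ 3)
  (fun s => dotv (grad f (x + s *: u)) u)
  (fun s => dotv (grad f x) u * (1%:R * s ^+ 0) +
     quad (hess f x) u / 2 * (2%:R * s ^+ 1) +
     (L2 / 6 * enorm u ^+ 3) * (3%:R * s ^+ 2)) 1 ler01.
rewrite !scale1r scale0r addr0 => H.
suff : f (x + u) - f x <=
  dotv (grad f x) u * 1 ^+ 1 + quad (hess f x) u / 2 * 1 ^+ 2 +
    L2 / 6 * enorm u ^+ 3 * 1 ^+ 3 -
  (dotv (grad f x) u * 0 ^+ 1 + quad (hess f x) u / 2 * 0 ^+ 2 +
    L2 / 6 * enorm u ^+ 3 * 0 ^+ 3).
  by rewrite !expr1n !expr0n/=; lra.
apply: H => [t|t|t /andP[t0 _]]; first exact: is_derive_grad_line.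
  by do 2 (try apply: is_deriveD); exact: is_derive_monomial.
by have := grad_line_le x u t0; rewrite expr0; lra.
Qed.

Lemma is_derive_second_diff x u v (t : R) :
  is_derive t 1 (fun s : R => f (x + v + s *: u) - f (x + s *: u))
    (dotv (grad f (x + t *: u + v)) u - dotv (grad f (x + t *: u)) u).
Proof.
rewrite [x + t *: u + v]addrAC.
exact: (is_deriveB (is_derive_grad_line (x + v) u t) (is_derive_grad_line x u t)).
Qed.

(** Both steps of the second difference are estimated by the mean value theorem,
    first along [u], then along [v]; the error is the variation of the Hessian
    over the parallelogram spanned by [u] and [v]. *)
Lemma second_diff_approx x u v :
  `|f (x + v + u) - f (x + u) - (f (x + v) - f x) - dotv u (hess f x *m v)|
    <= L2 * (enorm u + enorm v) * (enorm u * enorm v).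
Proof.
have -> : f (x + v + u) - f (x + u) - (f (x + v) - f x) =
  (f (x + v + 1 *: u) - f (x + 1 *: u)) - (f (x + v + 0 *: u) - f (x + 0 *: u)).
  by rewrite !scale1r !scale0r !addr0.
apply: (increment_approx (is_derive_second_diff x u v)) => t /andP[t0 t1].
have -> : dotv (grad f (x + t *: u + v)) u - dotv (grad f (x + t *: u)) u =
  dotv (grad f (x + t *: u + 1 *: v)) u - dotv (grad f (x + t *: u + 0 *: v)) u.
  by rewrite scale1r scale0r addr0.
apply: (increment_approx (is_derive_dotv_grad_line (x + t *: u) v u)).
move=> s /andP[s0 s1].
rewrite -dotvNr -dotvDr -mulmxBl; apply: le_trans (dotv_mul_le _ _ _) _.
rewrite [enorm u * enorm v]mulrC [leRHS]mulrA !ler_wpM2r ?enorm_ge0//.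
apply: le_trans (hessL _ _) _; rewrite ler_wpM2l//.
rewrite -(addrA x) add_subl; apply: le_trans (enormD _ _) _.
by rewrite !enormZ !ger0_norm// lerD// ler_piMl ?enorm_ge0.
Qed.

(** Schwarz's theorem. The second difference is symmetric in its two increments,
    so by [second_diff_approx] the antisymmetric part of the Hessian, tested on
    [s *: u] and [s *: v], is of order [s ^+ 2] and yet bounded by a multiple of
    [s ^+ 3]. *)
Lemma hess_sym x : (hess f x)^T = hess f x.
Proof.
suff key u v : dotv u (hess f x *m v) - dotv v (hess f x *m u) = 0.
  apply/matrixP => i j; rewrite mxE.
  have /eqP := key (delta_mx j 0) (delta_mx i 0); rewrite subr_eq0 => /eqP.
  have entry (A : 'M[R]_d) k l : dotv (delta_mx k 0) (A *m delta_mx l 0) = A k l.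
    by rewrite -colE /dotv trmx_delta -rowE !mxE.
  by rewrite !entry.
pose e := L2 * (enorm u + enorm v) * (enorm u * enorm v).
apply: (@small_multiple_eq0 R _ (e + e)) => s s0.
have := second_diff_approx x (s *: u) (s *: v).
have := second_diff_approx x (s *: v) (s *: u).
rewrite !enormZ !(gtr0_norm s0) -!scalemxAr !dotvZl !dotvZr.
rewrite [x + s *: u + s *: v]addrAC.
rewrite /e !ler_norml => /andP[h1 h2] /andP[h3 h4].
apply/andP; split; lra.
Qed.

End Taylor.

(** * Borel measurability of matrix-valued maps *)

Section MatrixContinuity.
Context {R : realType}.

Lemma continuous_sum (T : topologicalType) (I : Type) (r : seq I) (F : I -> T -> R) :
  (forall i, continuous (F i)) -> continuous (fun x => \sum_(i <- r) F i x).
Proof.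
move=> cF; apply: (@continuous_big _ _ +%R 0 xpredT) => //.
exact: add_continuous.
Qed.

Lemma continuous_sqrt_sumsq (T : topologicalType) (I : finType) (F : I -> T -> R) :
  (forall i, continuous (F i)) ->
  continuous (fun x => Num.sqrt (\sum_i F i x ^+ 2)).
Proof.
move=> cF x; apply: (@continuous_comp _ _ _ _ (@Num.sqrt R)); last first.
  exact: sqrt_continuous.
apply: continuous_sum => i y.
apply: (@continuous_comp _ _ _ (F i) (fun z : R => z ^+ 2)); first exact: cF.
exact: exprn_continuous.
Qed.

Lemma enorm_continuous d : continuous (enorm : 'cV[R]_d -> R).
Proof. by apply: continuous_sqrt_sumsq => i; exact: coord_continuous. Qed.

Lemma mulmx_coord_continuous d (u : 'cV[R]_d) i :
  continuous (fun A : 'M[R]_d => (A *m u) i 0).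
Proof.
rewrite (_ : (fun A => _) = fun A : 'M[R]_d => \sum_j A i j * u j 0); last first.
  by apply/funext => A; rewrite mxE.
apply: continuous_sum => j A.
have c : continuous (fun B : 'M[R]_d => B i j) by exact: coord_continuous.
exact: (cvgM (c A) (cvg_cst _)).
Qed.

(** An intersection of closed conditions, one for each vector of the unit ball.
    It makes the domain of the randomized eigenvector routine measurable. *)
Lemma closed_spectral_norm d (L : R) :
  closed [set A : 'M[R]_d | spectral_norm A <= L].
Proof.
rewrite (_ : [set A | _] = \bigcap_(u in [set u : 'cV[R]_d | enorm u <= 1])
   (fun A : 'M[R]_d => enorm (A *m u)) @^-1` [set x | x <= L]).
  apply: closed_bigI => u _; apply: preimage_closed; last exact: closed_le.
  move=> A _; apply: continuous_sqrt_sumsq => i; exact: mulmx_coord_continuous.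
by apply/seteqP; split=> A /= /spectral_norm_leP.
Qed.

Lemma closed_psd d : closed [set A : 'M[R]_d | forall u, 0 <= quad A u].
Proof.
rewrite (_ : [set A | _] = \bigcap_(u in [set: 'cV[R]_d])
   (fun A : 'M[R]_d => quad A u) @^-1` [set x | 0 <= x]).
  apply: closed_bigI => u _; apply: preimage_closed; last exact: closed_ge.
  move=> A _.
  rewrite (_ : (fun A => _) = fun A : 'M[R]_d => \sum_i u i 0 * (A *m u) i 0).
    apply: continuous_sum => i B.
    exact: (cvgM (cvg_cst _) (@mulmx_coord_continuous _ u i B)).
  by apply/funext => B; rewrite quadE dotvE.
by apply/seteqP; split=> [A /= h u _|A /= h u]; exact: h.
Qed.

Lemma hess_entry_continuous d (f : 'cV[R]_d -> R) (L2 : R) i j :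
  (forall x y, spectral_norm (hess f x - hess f y) <= L2 * enorm (x - y)) ->
  continuous (fun x => hess f x i j).
Proof.
move=> hL x; have Fx : Filter (nbhs x) := nbhs_filter x.
suff : hess f y i j @[y --> x] --> hess f x i j by [].
apply/cvgrPdist_lt => e e0.
have c : continuous (fun y : 'cV[R]_d => enorm (x - y)).
  move=> y; apply: (@continuous_comp _ _ _ (fun y : 'cV[R]_d => x - y) enorm).
    by apply: (@continuousB _ _ _ (cst x) id); [exact: cst_continuous|move=> ?].
  exact: enorm_continuous.
have : L2 * enorm (x - y) @[y --> x] --> L2 * enorm (x - x).
  exact: (cvgM (cvg_cst L2) (c x)).
rewrite subrr enorm0 mulr0 => /cvgr_lt /(_ _ e0).
apply: filterS => y; apply: le_lt_trans.
apply: le_trans (hL x y).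
by have := entry_le_spectral (hess f x - hess f y) i j; rewrite !mxE.
Qed.

End MatrixContinuity.

Section MatrixMeasurability.
Context {R : realType}.

Lemma measurable_set_lt d (T : measurableType d) (f g : T -> R) :
  measurable_fun [set: T] f -> measurable_fun [set: T] g ->
  measurable [set t | f t < g t].
Proof.
move=> mf mg; have := measurable_fun_ltr mf mg measurableT (Y := [set true]) I.
by rewrite setTI.
Qed.

Lemma measurable_set_le d (T : measurableType d) (f g : T -> R) :
  measurable_fun [set: T] f -> measurable_fun [set: T] g ->
  measurable [set t | f t <= g t].
Proof.
move=> mf mg; have := measurable_fun_ler mf mg measurableT (Y := [set true]) I.
by rewrite setTI.
Qed.

Lemma open_measurable_mx m n (U : set 'M[R]_(m, n)) :
  open U -> measurable (U : set (borel_mx R m n)).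
Proof. by move=> oU; exact: sub_sigma_algebra. Qed.

Lemma closed_measurable_mx m n (U : set 'M[R]_(m, n)) :
  closed U -> measurable (U : set (borel_mx R m n)).
Proof.
move=> cU; rewrite -(setCK U); apply: measurableC.
by apply: open_measurable_mx; exact: closed_openC.
Qed.

Lemma continuous_measurable_mxr m n (g : 'M[R]_(m, n) -> R) :
  continuous g -> measurable_fun [set: borel_mx R m n] g.
Proof.
move=> cg; apply: (measurability _ (RGenOInfty.measurableE R)) => _ [_ [a ->] <-].
rewrite setTI; apply: open_measurable_mx; apply: open_comp => //.
Qed.

Lemma measurable_entry d (T : measurableType d) m n (F : T -> borel_mx R m n) i j :
  measurable_fun [set: T] F -> measurable_fun [set: T] (fun t => F t i j).
Proof.
move=> mF; apply: (measurableT_comp (f := fun A : borel_mx R m n => A i j)) => //.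
by apply: continuous_measurable_mxr; exact: coord_continuous.
Qed.

(** The open sets of matrices are countable unions of boxes with rational center
    and size, and the preimage of a box is a finite intersection of conditions
    on entries. *)
Lemma measurable_fun_mx d (T : measurableType d) m n (F : T -> borel_mx R m n) :
  (forall i j, measurable_fun [set: T] (fun t => F t i j)) ->
  measurable_fun [set: T] F.
Proof.
have mE : @measurable _ (borel_mx R m n) = <<s @open 'M[R]_(m, n) >> by [].
move=> mF; apply: (measurability _ mE) => _ [U oU <-].
rewrite setTI.
pose box (p : 'M[rat]_(m, n) * rat) : set 'M[R]_(m, n) :=
  [set A | forall i j, `|A i j - ratr (p.1 i j)| < ratr p.2].
have -> : F @^-1` U = \bigcup_p
    (if pselect (box p `<=` U) then F @^-1` box p else set0).
  apply/seteqP; split=> [t /= Ut|t [p _]]; last first.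
    by case: pselect => // pU /pU.
  have /nbhs_ballP[e /= e0 eU] : nbhs (F t : 'M[R]_(m, n)) U.
    exact: open_nbhs_nbhs.
  have e2 : 0 < e / 2 by rewrite divr_gt0.
  have [r] := rat_in_itvoo e2; rewrite in_itv/= => /andP[r0 re].
  have /choice[b bP] (ij : 'I_m * 'I_n) :
      exists q : rat, `|F t ij.1 ij.2 - ratr q| < ratr r.
    have ab : F t ij.1 ij.2 - ratr r < F t ij.1 ij.2 + ratr r by lra.
    have [q] := rat_in_itvoo ab; rewrite in_itv/= => qab.
    by exists q; rewrite ltr_distlC.
  exists (\matrix_(i, j) b (i, j), r) => //.
  case: pselect => [_ i j|[A hA]] /=; first by rewrite mxE; exact: (bP (i, j)).
  apply: eU; split=> // i j; rewrite /ball/=.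
  have := hA i j; have := bP (i, j); rewrite /= mxE distrC => h1 h2.
  have := ler_distD (ratr (b (i, j))) (F t i j) (A i j).
  rewrite (distrC (F t i j) (ratr _)) (distrC (ratr _) (A i j)); lra.
apply: countable_bigcupT_measurable; first exact: countableP.
move=> p; case: pselect => [pU|pU]; last exact: measurable0.
rewrite (_ : _ @^-1` _ = \bigcap_(ij in [set: 'I_m * 'I_n])
   [set t | `|F t ij.1 ij.2 - ratr (p.1 ij.1 ij.2)| < ratr p.2]).
  apply: fin_bigcap_measurable; first exact: finite_finset.
  move=> [i j] _ /=; apply: measurable_set_lt; last exact: measurable_cst.
  apply: measurableT_comp => //; apply: measurable_funD => //; exact: mF.
by apply/seteqP; split=> [t /= h [i j] _|t /= h i j]; [exact: h|exact: (h (i, j))].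
Qed.

End MatrixMeasurability.

(** * Markov chains driven by independent seeds *)

Section ChainOfIndependentSeeds.
Context {R : realType} {dO dS dX : measure_display}.
Context {Omega : measurableType dO} {S : measurableType dS} {X : measurableType dX}.
Variables (P : probability Omega R).

(** Uniqueness of measures: on the product space, the law of [W] restricted to [C]
    and the law of [W] scaled by [P C] agree on rectangles. *)
Lemma indep_event_rectangles (W : {mfun Omega >-> (X * S)%type}) (C : set Omega) :
  measurable C ->
  (forall E B, measurable E -> measurable B ->
     P (W @^-1` (E `*` B) `&` C) = (P (W @^-1` (E `*` B)) * P C)%E) ->
  forall F, measurable F -> P (W @^-1` F `&` C) = (P (W @^-1` F) * P C)%E.
Proof.
move=> mC rect F mF.
have fC : P C \is a fin_num by exact: fin_num_measure.
pose m2 := mscale (NngNum (fine_ge0 (measure_ge0 P C))) (distribution P W).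
have m2E A : m2 A = (P (W @^-1` A) * P C)%E.
  by rewrite /m2 /mscale /= fineK// muleC.
rewrite -m2E; change (pushforward (mrestr P mC) W F = m2 F).
pose rectangles : set (set (X * S)) :=
  [set A `*` B | A in measurable & B in measurable].
apply: (measure_unique rectangles (fun=> setT)) => //.
- by rewrite measurable_prod_measurableType.
- move=> _ _ [A1 mA1 [B1 mB1 <-]] [A2 mA2 [B2 mB2 <-]].
  exists (A1 `&` A2); first exact: measurableI.
  exists (B1 `&` B2); first exact: measurableI.
  by rewrite setXI.
- by move=> _; exists setT => //; exists setT => //; rewrite setXTT.
- by rewrite bigcup_const.
- by move=> _ [A mA [B mB <-]]; apply: etrans (esym (m2E _)); exact: rect.
- move=> _; change (P (W @^-1` setT `&` C) < +oo)%E.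
  by rewrite preimage_setT setTI -ge0_fin_numE.
Qed.

(** The joint law of [Z] and [xi] is the product of their laws, so the
    probability is the average over the law of [Z] of the probabilities of the
    sections. *)
Lemma fresh_seed_bound (mu : probability S R) (Z : {mfun Omega >-> X})
    (xi : {mfun Omega >-> S}) (F : set (X * S)) (p : R) :
  (forall E B, measurable E -> measurable B ->
     P (Z @^-1` E `&` xi @^-1` B) = (P (Z @^-1` E) * mu B)%E) ->
  measurable F -> (forall x, mu (xsection F x) <= p%:E)%E ->
  (P [set w | F (Z w, xi w)] <= p%:E)%E.
Proof.
move=> ind mF Fp.
have mW : measurable_fun [set: Omega] (fun w => (Z w, xi w)).
  exact: measurable_fun_pair.
pose W : {mfun Omega >-> (X * S)%type} := mfun_Sub (mem_set mW).
pose nu : probability X R := distribution P Z.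
have <- : (nu \x mu)%E F = P [set w | F (Z w, xi w)].
  exact: (@product_measure_unique _ _ _ _ _ nu mu (distribution P W)).
rewrite /product_measure1.
apply: (@le_trans _ _ (\int[nu]_x (p%:E))%E).
  by apply: ge0_le_integral => //=; exact: measurable_fun_xsection.
by rewrite integral_cst//= /nu probability_setT mule1.
Qed.

Variables (xi : nat -> {RV P >-> S}) (Z : nat -> Omega -> X) (Phi : X * S -> X).
Variable x0 : X.
Hypothesis mPhi : measurable_fun [set: X * S] Phi.
Hypothesis Z1 : forall w, Z 1 w = x0.
Hypothesis ZS : forall j w, Z j.+2 w = Phi (Z j.+1 w, xi j.+1 w).

Lemma chain_measurable j : measurable_fun [set: Omega] (Z j.+1).
Proof.
elim: j => [|j IH].
  by rewrite (_ : Z 1 = cst x0) //; apply/funext.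
rewrite (_ : Z j.+2 = Phi \o (fun w => (Z j.+1 w, xi j.+1 w))); last exact/funext.
by apply: measurableT_comp => //; exact: measurable_fun_pair.
Qed.

(** The state of the chain is independent of the seeds that it has not consumed
    yet. In the induction the next state is a function of the pair formed by the
    current state and the current seed. Events on the unused seeds are
    independent of that pair on rectangles, by the induction hypothesis applied
    to [J] and to [[::]], each enlarged by the current seed, and hence on all
    measurable sets. *)
Lemma chain_independent j (E : set X) (J : seq nat) (A : nat -> set S) :
  mutually_independent xi -> measurable E ->
  uniq J -> (forall k, k \in J -> (j < k)%N) -> (forall k, measurable (A k)) ->
  P (Z j.+1 @^-1` E `&` \bigcap_(k in [set` J]) (xi k @^-1` A k)) =
  (P (Z j.+1 @^-1` E) * \prod_(k <- J) P (xi k @^-1` A k))%E.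
Proof.
move=> ind; elim: j E J A => [|j IH] E J A mE uJ Jj mA.
  have [xE|xE] := pselect (E x0).
    rewrite (_ : Z 1 @^-1` E = setT) ?setTI ?probability_setT ?mul1e ?ind//.
    by apply/seteqP; split=> w //= _; rewrite Z1.
  rewrite (_ : Z 1 @^-1` E = set0) ?set0I ?measure0 ?mul0e//.
  by apply/seteqP; split=> w //=; rewrite Z1.
set C := \bigcap_(k in _) _.
have mxi k : measurable (xi k @^-1` A k).
  by rewrite -[X in measurable X]setTI; exact: measurable_funP.
have mC : measurable C by exact: bigcap_measurableType.
have mW : measurable_fun [set: Omega] (fun w => (Z j.+1 w, xi j.+1 w)).
  by apply: measurable_fun_pair => //; exact: chain_measurable.
pose W : {mfun Omega >-> (X * S)%type} := mfun_Sub (mem_set mW).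
have -> : Z j.+2 @^-1` E = W @^-1` (Phi @^-1` E).
  by apply/seteqP; split=> w /=; rewrite ZS.
have PC : P C = (\prod_(k <- J) P (xi k @^-1` A k))%E by exact: ind.
rewrite -PC; apply: indep_event_rectangles => //; last first.
  by rewrite -[X in measurable X]setTI; exact: mPhi.
move=> {}E B {}mE mB.
(* The events of the induction hypothesis: the constraint B on the current
   seed is added to the constraints on the later ones. *)
pose A' k := if k == j.+1 then B else A k.
have mA' k : measurable (A' k) by rewrite /A'; case: ifP.
have jJ : j.+1 \notin J by apply/negP => /Jj; rewrite ltnn.
have A'E : {in J, forall k, A' k = A k}.
  by move=> k kJ; rewrite /A'; case: eqP => // kj; move: jJ; rewrite -kj kJ.
have key K : K \in [:: J; [::]] ->
  P (Z j.+1 @^-1` E `&` \bigcap_(k in [set` j.+1 :: K]) (xi k @^-1` A' k)) =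
  (P (Z j.+1 @^-1` E) * \prod_(k <- j.+1 :: K) P (xi k @^-1` A' k))%E.
  rewrite !inE => KJ; apply: IH => //.
    by case/orP: KJ => /eqP -> //=; rewrite jJ.
  move=> k; rewrite inE => /orP[/eqP -> //|].
  by case/orP: KJ => /eqP -> // /Jj /ltnW.
have capE K : \bigcap_(k in [set` j.+1 :: K]) (xi k @^-1` A' k) =
    xi j.+1 @^-1` B `&` \bigcap_(k in [set` K]) (xi k @^-1` A' k).
  rewrite (_ : [set` j.+1 :: K] = j.+1 |` [set` K]) ?bigcap_setU1 /A' ?eqxx//.
  by apply/seteqP; split=> k /=; rewrite inE => /predU1P.
have CE : \bigcap_(k in [set` J]) (xi k @^-1` A' k) = C.
  by apply: eq_bigcapr => k /= kJ; rewrite A'E.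
have := key J; rewrite inE eqxx => /(_ isT); rewrite capE CE big_cons.
have := key [::]; rewrite !inE eqxx orbT => /(_ isT).
rewrite capE big_cons big_nil mule1 classical_sets.set_nil bigcap_set0 setIT.
rewrite (_ : W @^-1` (E `*` B) = Z j.+1 @^-1` E `&` xi j.+1 @^-1` B)//.
move=> -> ; rewrite setIA => ->; rewrite -muleA PC; congr (_ * (_ * _))%E.
by rewrite big_seq [RHS]big_seq; apply: eq_bigr => k kJ; rewrite A'E.
Qed.

End ChainOfIndependentSeeds.

(** * Decrease of the objective and termination *)

Section StepDecrease.
Context {R : realType} {d : nat} {dS : measure_display} {S : measurableType dS}.
Variables (f : 'cV[R]_d -> R) (H : 'cV[R]_d -> 'M[R]_d).
Variable lz : lanczos_routine R d S.
Variables (L1 L2 eps1 eps2 eps3 : R).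
Hypothesis L1_gt0 : 0 < L1.
Hypothesis L2_gt0 : 0 < L2.
Hypothesis eps1_gt0 : 0 < eps1.
Hypothesis eps2_gt0 : 0 < eps2.
Hypothesis f2 : twice_differentiable f.
Hypothesis gradL :
  forall x y, enorm (grad f x - grad f y) <= L1 * enorm (x - y).
Hypothesis hessL :
  forall x y, spectral_norm (hess f x - hess f y) <= L2 * enorm (x - y).
Hypothesis eps3_le : eps3 <= eps2 / 12.
Hypothesis H_approx : forall x, spectral_norm (H x - hess f x) <= eps3.

Lemma sign1M (t : R) : sign1 t * t = `|t|.
Proof.
rewrite /sign1; case: ifPn => [t0|]; first by rewrite mul1r ger0_norm.
by rewrite -ltNge mulN1r => /ltr0_norm.
Qed.

Lemma normr_sign1 (t : R) : `|sign1 t| = 1.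
Proof. by rewrite /sign1; case: ifP; rewrite ?normrN normr1. Qed.

Lemma quad_hess_approx x u :
  `|quad (H x) u - quad (hess f x) u| <= eps3 * enorm u ^+ 2.
Proof.
rewrite -quadB; apply: le_trans (quad_le _ _) _.
by rewrite ler_wpM2r ?sqr_ge0.
Qed.

(** The step length [L1^-1] minimizes the quadratic upper model given by
    [grad_descent]. *)
Lemma grad_step_decrease x :
  f (x - L1^-1 *: grad f x) <= f x - enorm (grad f x) ^+ 2 / (2 * L1).
Proof.
apply: le_trans (grad_descent f2 x (- (L1^-1 *: grad f x)) gradL) _.
rewrite dotvNr dotvZr -sqr_enorm enormN enormZ exprMn.
rewrite real_normK ?num_real// le_eqVlt; apply/orP; left; apply/eqP.
by field; rewrite ?lt0r_neq0.
Qed.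

(** The sign makes the first-order term nonpositive, so it can be dropped. With
    [a = eps2 / L2] the third-order term of [hess_descent] is
    [a ^+ 2 * eps2 / 6], and replacing the Hessian by [H] in the second-order
    term costs [a ^+ 2 * eps2 / 24]; together they give the coefficient 5/24. *)
Lemma curvature_step_decrease x v : enorm v = 1 ->
  f (x - (eps2 / L2 * sign1 (dotv v (grad f x))) *: v) <=
  f x - (- (eps2 ^+ 2 / (2 * L2 ^+ 2)) * quad (H x) v
         - 5 * eps2 ^+ 3 / (24 * L2 ^+ 2)).
Proof.
move=> v1; set a := eps2 / L2; set s := sign1 _.
have a0 : 0 < a by rewrite divr_gt0.
have sE : - (a * s) * dotv v (grad f x) = - (a * `|dotv v (grad f x)|).
  by rewrite mulNr -mulrA sign1M.
have sn : `|- (a * s)| = a by rewrite normrN normrM normr_sign1 mulr1 gtr0_norm.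
have := hess_descent f2 hessL x (- ((a * s) *: v)).
rewrite -scaleNr dotvZr dotvC quadZ enormZ v1 mulr1 sn sE => h.
have hs : (- (a * s)) ^+ 2 = a ^+ 2.
  by rewrite sqrrN exprMn -[s ^+ 2]real_normK ?num_real// normr_sign1 expr1n mulr1.
rewrite {}hs in h.
have := quad_hess_approx x v; rewrite v1 expr1n mulr1 ler_norml => /andP[q1 _].
apply: le_trans h _.
have ag : 0 <= a * `|dotv v (grad f x)| by rewrite mulr_ge0// ltW.
have hq : a ^+ 2 * quad (hess f x) v <= a ^+ 2 * (quad (H x) v + eps2 / 12).
  rewrite ler_pM2l ?exprn_gt0//.
  apply: le_trans (_ : quad (H x) v + eps3 <= _); last by rewrite lerD2l.
  by rewrite -lerBlDl -lerN2 opprB.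
have E1 : eps2 ^+ 2 / (2 * L2 ^+ 2) = a ^+ 2 / 2.
  by rewrite /a; field; rewrite ?lt0r_neq0.
have E2 : 5 * eps2 ^+ 3 / (24 * L2 ^+ 2) = 5 / 24 * a ^+ 2 * eps2.
  by rewrite /a; field; rewrite ?lt0r_neq0.
have E3 : L2 / 6 * a ^+ 3 = a ^+ 2 * eps2 / 6.
  by rewrite /a; field; rewrite ?lt0r_neq0.
rewrite E1 E2 E3; set q := quad (H x) v in hq *.
set qh := quad (hess f x) v in hq *.
set A := a ^+ 2 in hq *; lra.
Qed.

(** The inverse of the decrease guaranteed at each iteration that does not stop,
    so that [iter_bound] is [1 + rate * Delta]. *)
Definition rate : R := Num.max (24 * L2 ^+ 2 / eps2 ^+ 3) (2 * L1 / eps1 ^+ 2).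

Lemma rate_gt0 : 0 < rate.
Proof.
by rewrite lt_max; apply/orP; left; rewrite divr_gt0 ?mulr_gt0 ?exprn_gt0.
Qed.

(** The algorithm takes the step whose guaranteed decrease is larger, so it is
    enough to bound one of the two. If the stopping test fails because of the
    curvature, the curvature step gains at least
    [(1/4 - 5/24) * eps2 ^+ 3 / L2 ^+ 2]; if it fails because of the gradient,
    the gradient step gains at least [eps1 ^+ 2 / (2 * L1)]. *)
Lemma step_decrease x eps delta s :
  let v := lz_vec lz (H x) eps delta s in
  enorm v = 1 ->
  ~ (- (eps2 / 2) < quad (H x) v /\ enorm (grad f x) <= eps1) ->
  f (ih_ncg f H lz L1 L2 x eps delta eps2 s).1 <= f x - rate^-1.
Proof.
move=> v v1 nstop; have hc := curvature_step_decrease x v1.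
have hg := grad_step_decrease x.
rewrite /ih_ncg /= -/v.
set A := - (eps2 ^+ 2 / _) * _ - _ in hc *.
set B := enorm (grad f x) ^+ 2 / _ in hg *.
have : f (if B < A then x - (eps2 / L2 * sign1 (dotv v (grad f x))) *: v
          else x - L1^-1 *: grad f x) <= f x - Num.max A B.
  by rewrite maxC /Num.max; case: ifP.
move/le_trans; apply; rewrite lerD2l lerN2 le_max.
have r0 := rate_gt0.
have rV c : 0 < c -> c <= rate -> rate^-1 <= c^-1.
  by move=> c0 cr; rewrite lef_pV2.
have [q_le|q_gt] := leP (quad (H x) v) (- (eps2 / 2)).
  apply/orP; left; apply: (@le_trans _ _ (24 * L2 ^+ 2 / eps2 ^+ 3)^-1).
    by apply: rV; rewrite ?divr_gt0 ?mulr_gt0 ?exprn_gt0// le_max lexx.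
  have c0 : 0 < eps2 ^+ 2 / (2 * L2 ^+ 2).
    by rewrite divr_gt0 ?mulr_gt0 ?exprn_gt0.
  rewrite /A; set c := eps2 ^+ 2 / _ in c0 *.
  have -> : (24 * L2 ^+ 2 / eps2 ^+ 3)^-1 = c * (eps2 / 12).
    by rewrite /c; field; rewrite ?lt0r_neq0.
  have -> : 5 * eps2 ^+ 3 / (24 * L2 ^+ 2) = c * (5 * eps2 / 12).
    by rewrite /c; field; rewrite ?lt0r_neq0.
  have := ler_wpM2l (ltW c0) q_le; lra.
have [g_le|g_gt] := leP (enorm (grad f x)) eps1; first by case: nstop.
apply/orP; right; apply: (@le_trans _ _ (2 * L1 / eps1 ^+ 2)^-1).
  by apply: rV; rewrite ?divr_gt0 ?mulr_gt0 ?exprn_gt0// le_max lexx orbT.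
rewrite invf_div /B ler_pM2r ?invr_gt0 ?mulr_gt0//.
by rewrite ler_pXn2r ?nnegrE ?enorm_ge0// ltW.
Qed.

End StepDecrease.

Section Termination.
Context {R : realType} {d : nat} {dS : measure_display} {S : measurableType dS}.
Variables (f : 'cV[R]_d -> R) (H : 'cV[R]_d -> 'M[R]_d).
Variable lz : lanczos_routine R d S.
Variables (L1 L2 Delta : R) (x0 xstar : 'cV[R]_d) (eps1 eps2 delta : R).
Hypothesis L2_gt0 : 0 < L2.
Hypothesis eps2_gt0 : 0 < eps2.
Hypothesis xstar_min : forall x, f xstar <= f x.
Hypothesis gap : f x0 - f xstar <= Delta.

Local Notation x_ := (iterate f H lz L1 L2 Delta x0 eps1 eps2 delta).
Local Notation stop := (stop_test f H lz L1 L2 Delta x0 eps1 eps2 delta).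
Local Notation exec := (executed f H lz L1 L2 Delta x0 eps1 eps2 delta).
Local Notation m := (rate L1 L2 eps1 eps2).
Local Notation K := (iter_bound L1 L2 Delta eps1 eps2).

Hypothesis step : forall w j,
  ~ stop w j.+1 -> f (x_ w j.+2) <= f (x_ w j.+1) - m^-1.

Lemma iter_bound_ge1 : 1 <= K.
Proof.
rewrite lerDl mulr_ge0 ?(ltW (rate_gt0 _ _ _ _))//.
by apply: le_trans gap; rewrite subr_ge0.
Qed.

Lemma executed_value w j : exec w j.+1 -> f (x_ w j.+1) <= f x0 - j%:R / m.
Proof.
elim: j => [|j IH] [_ ex]; first by rewrite mul0r subr0.
have nst : ~ stop w j.+1 by apply: ex; rewrite ltnSn.
have ex' : exec w j.+1.
  by split=> // i /andP[i0 ij]; apply: ex; rewrite i0 ltnW.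
have := IH ex'; have := step nst; rewrite -natr1 mulrDl; lra.
Qed.

(** The objective cannot fall by more than [Delta]. *)
Lemma executed_le_iter_bound w j : exec w j -> j%:R <= K.
Proof.
case: j => [[]//|j] /executed_value h.
have m0 : 0 < m by exact: rate_gt0.
rewrite -natr1 addrC lerD2l -ler_pdivrMl// mulrC.
apply: le_trans gap; rewrite lerBrDr -lerBrDl.
exact: le_trans (xstar_min _) h.
Qed.

Lemma run_halts w : exists j, halts_at f H lz L1 L2 Delta x0 eps1 eps2 delta w j.
Proof.
have [j0 /andP[j0_gt0 /asboolP st0]] : exists j, (0 < j)%N && `[< stop w j >].
  apply: contrapT => nst.
  have K0 : 0 <= K by apply: le_trans iter_bound_ge1.
  have : ((Num.truncn K).+1)%:R <= K.
    apply: (@executed_le_iter_bound w); split=> // i /andP[i0 _] st.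
    by apply: nst; exists i; rewrite i0; apply/asboolP.
  by rewrite leNgt; have := truncnS_gt K => ->.
have ex : exists j, (0 < j)%N && `[< stop w j >].
  by exists j0; rewrite j0_gt0; apply/asboolP.
case: (ex_minnP ex) => j /andP[j0' /asboolP st] jmin.
exists j; split=> //; split=> // i /andP[i0 ij] sti.
have : (j <= i)%N by apply: jmin; rewrite i0; apply/asboolP.
by rewrite leqNgt ij.
Qed.

End Termination.

(** * Measurability of one iteration *)

Section MeasurableMatrixOperations.
Context {R : realType} {dT : measure_display} {T : measurableType dT}.

Lemma measurable_enorm n (F : T -> borel_mx R n 1) :
  measurable_fun [set: T] F -> measurable_fun [set: T] (fun t => enorm (F t)).
Proof.
move=> mF; apply: (measurableT_comp (f := enorm : borel_mx R n 1 -> R)) => //.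
by apply: continuous_measurable_mxr; exact: enorm_continuous.
Qed.

Lemma measurable_dotv n (F G : T -> borel_mx R n 1) :
  measurable_fun [set: T] F -> measurable_fun [set: T] G ->
  measurable_fun [set: T] (fun t => dotv (F t) (G t)).
Proof.
move=> mF mG; under eq_fun do rewrite dotvE.
by apply: measurable_sum => i; apply: measurable_funM; exact: measurable_entry.
Qed.

Lemma measurable_mulmx m n p (F : T -> borel_mx R m n) (G : T -> borel_mx R n p) :
  measurable_fun [set: T] F -> measurable_fun [set: T] G ->
  measurable_fun [set: T] (fun t => F t *m G t : borel_mx R m p).
Proof.
move=> mF mG; apply: measurable_fun_mx => i j.
under eq_fun do rewrite mxE.
by apply: measurable_sum => k; apply: measurable_funM; exact: measurable_entry.
Qed.

Lemma measurable_quad n (F : T -> borel_mx R n n) (G : T -> borel_mx R n 1) :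
  measurable_fun [set: T] F -> measurable_fun [set: T] G ->
  measurable_fun [set: T] (fun t => quad (F t) (G t)).
Proof.
move=> mF mG; under eq_fun do rewrite quadE.
by apply: measurable_dotv => //; exact: measurable_mulmx.
Qed.

Lemma measurable_axpy n (a : T -> R) (F G : T -> borel_mx R n 1) :
  measurable_fun [set: T] a ->
  measurable_fun [set: T] F -> measurable_fun [set: T] G ->
  measurable_fun [set: T] (fun t => F t - a t *: G t : borel_mx R n 1).
Proof.
move=> ma mF mG; apply: measurable_fun_mx => i j.
under eq_fun do rewrite !mxE.
apply: measurable_funB; first exact: measurable_entry.
by apply: measurable_funM => //; exact: measurable_entry.
Qed.

(** By [lambda_min_geP] the set is the preimage of the closed cone of positive
    semidefinite matrices under [t |-> F t - (c t)%:M]. *)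
Lemma measurable_le_lambda_min n (F : T -> borel_mx R n n) (c : T -> R) :
  (0 < n)%N -> (forall t, (F t : 'M[R]_n)^T = F t) ->
  measurable_fun [set: T] F -> measurable_fun [set: T] c ->
  measurable [set t | c t <= lambda_min (F t)].
Proof.
move=> n0 sF mF mc.
pose G t : borel_mx R n n := (F t : 'M[R]_n) - (c t)%:M.
have mG : measurable_fun [set: T] G.
  apply: measurable_fun_mx => i j; rewrite /G.
  under eq_fun do rewrite !mxE.
  apply: measurable_funB; first exact: measurable_entry.
  by case: (i == j) => //=; exact: measurable_cst.
have := mG measurableT _ (closed_measurable_mx (@closed_psd R n)).
rewrite setTI; congr (measurable _); apply/seteqP.
have E t u : quad (G t) u = quad (F t) u - c t * enorm u ^+ 2.
  by rewrite /G quadB [X in _ - X]quadE mul_scalar_mx dotvZr sqr_enorm.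
split=> t /=.
  move=> h; apply/(lambda_min_geP _ n0 (sF t)) => u.
  by have := h u; rewrite E subr_ge0.
by move=> /(lambda_min_geP _ n0 (sF t)) h u; rewrite E subr_ge0.
Qed.

End MeasurableMatrixOperations.

Section MeasurableAlgorithm.
Context {R : realType} {d : nat} {dS : measure_display} {S : measurableType dS}.
Variables (f : 'cV[R]_d -> R) (H : 'cV[R]_d -> 'M[R]_d).
Variable lz : lanczos_routine R d S.
Variables (C M L1 L2 eps1 eps2 delta1 : R) (mu : probability S R).
Hypothesis d_gt0 : (0 < d)%N.
Hypothesis eps2_gt0 : 0 < eps2.
Hypothesis delta1_01 : 0 < delta1 < 1.
Hypothesis f2 : twice_differentiable f.
Hypothesis L2_ge0 : 0 <= L2.
Hypothesis hessL :
  forall x y, spectral_norm (hess f x - hess f y) <= L2 * enorm (x - y).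
Hypothesis mH :
  measurable_fun [set: borel_mx R d 1] (H : borel_mx R d 1 -> borel_mx R d d).
Hypothesis H_sym : forall x, (H x)^T = H x.
Hypothesis H_le : forall x, spectral_norm (H x) <= M.
Hypothesis lzP : lanczos_spec C M mu lz.

Local Notation X := (borel_mx R d 1).
Local Notation eps_ := (lanczos_eps f eps2).
Local Notation V := (fun q : X * S => lz_vec lz (H q.1) (eps_ q.1) delta1 q.2 : X).

Lemma lanczos_eps_gt0 x : 0 < eps_ x.
Proof. by rewrite divr_gt0// lt_max eps2_gt0. Qed.

Lemma lanczos_input_H x : lanczos_input M (H x : borel_mx R d d, eps_ x).
Proof. by split=> //=; exact: lanczos_eps_gt0. Qed.

Lemma measurable_lanczos_input : measurable (@lanczos_input R d M).
Proof.
have mfst i j : measurable_fun [set: borel_mx R d d * R] (fun p => p.1 i j : R).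
  by apply: measurable_entry; exact: measurable_fst.
pose D := (borel_mx R d d * R)%type.
rewrite (_ : lanczos_input M =
   (\bigcap_(ij in [set: 'I_d * 'I_d])
      [set p : D | p.1 ij.1 ij.2 = p.1 ij.2 ij.1]) `&`
   ([set p : D | spectral_norm p.1 <= M] `&` [set p : D | 0 < p.2])).
  apply: measurableI.
    apply: fin_bigcap_measurable; first exact: finite_finset.
    move=> [i j] _ /=.
    rewrite (_ : [set p | _] = [set p : D | p.1 i j <= p.1 j i] `&`
                               [set p : D | p.1 j i <= p.1 i j]).
      by apply: measurableI; exact: measurable_set_le.
    apply/seteqP; split=> p /=; first by move=> ->.
    by move=> [h1 h2]; apply/eqP; rewrite eq_le h1 h2.
  apply: measurableI.
    have := @measurable_fst _ _ (borel_mx R d d) R measurableT _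
      (closed_measurable_mx (@closed_spectral_norm R d M)).
    by rewrite setTI.
  by apply: measurable_set_lt; [exact: measurable_cst|exact: measurable_snd].
apply/seteqP; split=> p /=.
  move=> [h1 h2 h3]; split=> // -[i j] _ /=.
  by rewrite -[in LHS]h1 mxE.
move=> [h1 [h2 h3]]; split=> //; apply/matrixP => i j; rewrite mxE.
exact: (h1 (j, i)).
Qed.

Lemma measurable_grad : measurable_fun [set: X] (grad f : X -> X).
Proof.
apply: measurable_fun_mx => i j; rewrite ord1.
apply: continuous_measurable_mxr => x.
by apply: differentiable_continuous; exact: differentiable_grad_coord.
Qed.

Lemma measurable_hess : measurable_fun [set: X] (hess f : X -> borel_mx R d d).
Proof.
apply: measurable_fun_mx => i j.
by apply: continuous_measurable_mxr; exact: hess_entry_continuous hessL.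
Qed.

Lemma measurable_lanczos_eps : measurable_fun [set: X] (eps_ : X -> R).
Proof.
apply: measurable_funM; last exact: measurable_cst.
apply: measurable_maxr; first exact: measurable_cst.
by apply: measurable_enorm; exact: measurable_grad.
Qed.

Lemma measurable_lz_vec : measurable_fun [set: X * S] V.
Proof.
have mf := lz_measurable lzP delta1_01.
pose g (q : X * S) : (borel_mx R d d * R) * S :=
  ((H q.1 : borel_mx R d d, eps_ q.1), q.2).
apply: (measurable_comp (F := lanczos_input M `*` [set: S])
  (f := fun q : (borel_mx R d d * R) * S =>
         lz_vec lz q.1.1 q.1.2 delta1 q.2 : borel_mx R d 1) (g := g)) => //.
- by apply: measurableX => //; exact: measurable_lanczos_input.
- by move=> _ [q _ <-]; split => //; exact: lanczos_input_H.
apply: measurable_fun_pair; last exact: measurable_snd.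
apply: measurable_fun_pair.
  by apply: (measurableT_comp mH); exact: measurable_fst.
by apply: (measurableT_comp measurable_lanczos_eps); exact: measurable_fst.
Qed.

Let mHfst : measurable_fun [set: X * S] (fun q => H q.1 : borel_mx R d d).
Proof. by apply: (measurableT_comp mH); exact: measurable_fst. Qed.

Let mgfst : measurable_fun [set: X * S] (fun q => grad f q.1 : X).
Proof. by apply: (measurableT_comp measurable_grad); exact: measurable_fst. Qed.

Let mquad : measurable_fun [set: X * S] (fun q => quad (H q.1) (V q)).
Proof. by apply: measurable_quad => //; exact: measurable_lz_vec. Qed.

Lemma measurable_step : measurable_fun [set: X * S]
  (fun q => (ih_ncg f H lz L1 L2 q.1 (eps_ q.1) delta1 eps2 q.2).1 : X).
Proof.
rewrite /ih_ncg /=; apply: measurable_fun_ifT.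
- apply: measurable_fun_ltr.
    apply: measurable_funM; last exact: measurable_cst.
    by apply: measurable_funX; exact: measurable_enorm.
  by apply: measurable_funB => //; apply: measurable_funM.
- apply: measurable_axpy; [|exact: measurable_fst|exact: measurable_lz_vec].
  apply: measurable_funM => //; apply: measurable_fun_ifT => //.
  apply: measurable_fun_ler => //.
  by apply: measurable_dotv => //; exact: measurable_lz_vec.
- by apply: measurable_axpy => //; exact: measurable_fst.
Qed.

Lemma measurable_stop : measurable [set q : X * S |
  - (eps2 / 2) < quad (H q.1) (V q) /\ enorm (grad f q.1) <= eps1].
Proof.
apply: (@measurableI _ _ [set q | _] [set q | _]).
  exact: measurable_set_lt.
by apply: measurable_set_le => //; exact: measurable_enorm.
Qed.

(** The pairs of a point and a seed for which the routine overestimates the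
    smallest eigenvalue by more than its accuracy. *)
Definition lanczos_failure : set (X * S) :=
  [set q | ~ (quad (H q.1) (V q) - eps_ q.1 <= lambda_min (H q.1))].

Lemma measurable_lanczos_failure : measurable lanczos_failure.
Proof.
apply: (@measurableC _ _ [set q | _ <= _]).
apply: measurable_le_lambda_min => //.
apply: measurable_funB => //.
by apply: (measurableT_comp measurable_lanczos_eps); exact: measurable_fst.
Qed.

Lemma lanczos_failure_le x : (mu (xsection lanczos_failure x) <= delta1%:E)%E.
Proof.
have mX := measurable_xsection x measurable_lanczos_failure.
have := lz_correct lzP (lanczos_input_H x) delta1_01.
rewrite (_ : [set s | _] = ~` xsection lanczos_failure x); last first.
  apply/seteqP; split=> s /=; rewrite /xsection /= in_setE => h; first by apply.
  exact: contrapT.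
rewrite probability_setC//.
have := fin_num_measure mu _ mX; case: (mu _) => [r|//|//] _; last by rewrite leNye.
by rewrite -EFinB !lee_fin lerD2l lerN2.
Qed.

Lemma measurable_curvature (c : R) :
  measurable [set x : X | c <= lambda_min (hess f x)].
Proof.
apply: measurable_le_lambda_min => //; last exact: measurable_hess.
exact: hess_sym L2_ge0 hessL.
Qed.

End MeasurableAlgorithm.

(** * Curvature at the returned point and the complexity theorem *)

Section Guarantee.
Context {R : realType} {d : nat}.
Variables (f : 'cV[R]_d -> R) (H : 'cV[R]_d -> 'M[R]_d).
Variables (L1 L2 eps1 eps2 eps3 : R).
Hypothesis d_gt0 : (0 < d)%N.
Hypothesis eps2_gt0 : 0 < eps2.
Hypothesis eps3_le : eps3 <= eps2 / 12.
Hypothesis H_approx : forall x, spectral_norm (H x - hess f x) <= eps3.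
Hypothesis H_sym : forall x, (H x)^T = H x.
Hypothesis hess_symm : forall x, (hess f x)^T = hess f x.

(** The stopping test bounds the form at [v] by [- eps2 / 2], the accuracy of the
    routine costs at most half of [Num.max eps2 eps1], and the error of [H] at
    most a twelfth of it: the total [- (1/2 + 1/2 + 1/12)] times the maximum
    stays above [-2] times it. *)
Lemma curvature_guarantee x v :
  - (eps2 / 2) < quad (H x) v -> enorm (grad f x) <= eps1 ->
  quad (H x) v - lanczos_eps f eps2 x <= lambda_min (H x) ->
  - 2 * Num.max eps2 eps1 <= lambda_min (hess f x).
Proof.
move=> hq hg /(lambda_min_geP _ d_gt0 (H_sym x)) hl.
apply/(lambda_min_geP _ d_gt0 (hess_symm x)) => u.
have := quad_hess_approx H_approx x u; rewrite ler_norml => /andP[_ hu].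
have e1 : eps2 <= Num.max eps2 eps1 by rewrite le_max lexx.
have e2 : lanczos_eps f eps2 x <= Num.max eps2 eps1 / 2.
  by rewrite ler_pM2r ?invr_gt0// ge_max e1 le_max hg orbT.
have hc : - 2 * Num.max eps2 eps1 + eps3 <= quad (H x) v - lanczos_eps f eps2 x.
  by have := eps3_le; have := eps2_gt0; lra.
have := ler_wpM2r (sqr_ge0 (enorm u)) hc; have := hl u.
move=> h1 h2; move: (le_trans h2 h1); rewrite mulrDl.
by rewrite -lerBrDr => /le_trans; apply; rewrite lerBlDl -lerBlDr.
Qed.

End Guarantee.

(* The constant c of the time bound depends only on the constant C of the
   Lanczos cost bound. *)
Theorem theorem7 (R : realType) (C : R) (C_gt0 : 0 < C) :
  exists2 c : R, 0 < c &
  forall (d : nat) (f : 'cV[R]_d -> R) (H : 'cV[R]_d -> 'M[R]_d)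
    (L1 L2 : R) (x0 xstar : 'cV[R]_d) (Delta eps1 eps2 eps3 delta M Th : R)
    (dS dO : measure_display) (S : measurableType dS) (Omega : measurableType dO)
    (mu : probability S R) (P : probability Omega R)
    (xi : nat -> {RV P >-> S}) (lz : lanczos_routine R d S),
  (0 < d)%N ->
  0 < L1 -> 0 < L2 -> 0 < eps1 -> 0 < eps2 < 1 -> 0 < delta < 1 -> 0 <= Th ->
  twice_differentiable f ->
  (forall x y, enorm (grad f x - grad f y) <= L1 * enorm (x - y)) ->
  (forall x y, spectral_norm (hess f x - hess f y) <= L2 * enorm (x - y)) ->
  (forall x, f xstar <= f x) ->
  f x0 - f xstar <= Delta ->
  measurable_fun [set: borel_mx R d 1] (H : borel_mx R d 1 -> borel_mx R d d) ->
  (forall x, (H x)^T = H x) ->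
  eps3 <= eps2 / 12 ->
  (forall x, spectral_norm (H x - hess f x) <= eps3) ->
  (forall x, spectral_norm (H x) <= M) ->
  lanczos_spec C M mu lz ->
  fresh_seeds mu xi ->
  let K := iter_bound L1 L2 Delta eps1 eps2 in
  let run (omega : Omega) (j : nat) : S := xi j omega in
  let x_ := iterate f H lz L1 L2 Delta x0 eps1 eps2 delta in
  let halts := halts_at f H lz L1 L2 Delta x0 eps1 eps2 delta in
  let good := [set omega | exists2 j, halts (run omega) j &
      - 2 * Num.max eps2 eps1 <= lambda_min (hess f (x_ (run omega) j))] in
  [/\ forall omega, exists j, [/\ halts (run omega) j, j%:R <= K &
          enorm (grad f (x_ (run omega) j)) <= eps1],
      measurable good /\ ((1 - delta)%:E <= P good)%E
    & forall omega j,
        executed f H lz L1 L2 Delta x0 eps1 eps2 delta (run omega) j ->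
        iteration_time f H lz L1 L2 Delta x0 eps1 eps2 delta Th (run omega) j <=
          c * (Th * (Num.sqrt M /
                     Num.sqrt (Num.max eps2 (enorm (grad f (x_ (run omega) j)))))
                  * ln (d%:R / (delta / K)))].
Proof.
(* The accuracy requested from the routine is half of the maximum in the time
   bound, whence the factor sqrt 2. *)
exists (C * Num.sqrt 2); first by rewrite mulr_gt0 ?sqrtr_gt0.
move=> d f H L1 L2 x0 xstar Delta eps1 eps2 eps3 delta M Th dS dO S Omega mu P xi lz.
move=> d_gt0 L1_gt0 L2_gt0 eps1_gt0 /andP[eps2_gt0 _] /andP[delta_gt0 delta_lt1].
move=> Th_ge0 f2 gradL hessL xstar_min gap mH H_sym eps3_le H_approx H_le lzP.
move=> [xi_indep xi_law] K run x_ halts good.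
have K_ge1 : 1 <= K by exact: iter_bound_ge1 xstar_min gap.
have K_gt0 : 0 < K by exact: lt_le_trans K_ge1.
pose delta1 := delta / K.
have delta1_01 : 0 < delta1 < 1.
  by rewrite divr_gt0//= ltr_pdivrMr// mul1r (lt_le_trans delta_lt1).
have hess_symm := hess_sym f2 (ltW L2_gt0) hessL.
have input x : lanczos_input M (H x, lanczos_eps f eps2 x) by exact: lanczos_input_H.
have step w j : ~ stop_test f H lz L1 L2 Delta x0 eps1 eps2 delta w j.+1 ->
    f (x_ w j.+2) <= f (x_ w j.+1) - (rate L1 L2 eps1 eps2)^-1.
  move=> nst; apply: (step_decrease L1_gt0 L2_gt0 eps1_gt0 eps2_gt0 f2 gradL hessL
    eps3_le H_approx) => //.
  exact: (lz_unit lzP).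
have halting w := run_halts L2_gt0 eps2_gt0 xstar_min gap step w.
have exec_le := executed_le_iter_bound L2_gt0 eps2_gt0 xstar_min gap step.
split.
- move=> omega; have [j hj] := halting (run omega).
  exists j; split=> //; last by case: hj => _ [].
  by case: hj => ex _; exact: exec_le ex.
- pose X := borel_mx R d 1.
  pose Z (j : nat) (omega : Omega) : X := x_ (run omega) j.
  pose Phi (q : X * S) : X :=
    (ih_ncg f H lz L1 L2 q.1 (lanczos_eps f eps2 q.1) delta1 eps2 q.2).1.
  have mPhi : measurable_fun [set: X * S] Phi.
    exact: (measurable_step _ _ eps2_gt0 delta1_01 f2 mH H_sym H_le lzP).
  have Z1 omega : Z 1 omega = x0 by [].
  have ZS j omega : Z j.+2 omega = Phi (Z j.+1 omega, xi j.+1 omega) by [].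
  have mZ j : measurable_fun [set: Omega] (Z j.+1).
    exact: chain_measurable mPhi Z1 ZS j.
  have mZxi j : measurable_fun [set: Omega] (fun o => (Z j.+1 o, xi j.+1 o)).
    by apply: measurable_fun_pair.
  pose stops j := [set o |
    stop_test f H lz L1 L2 Delta x0 eps1 eps2 delta (run o) j.+1].
  have m_stops j : measurable (stops j).
    have mS := measurable_stop eps1 eps2_gt0 delta1_01 f2 mH H_sym H_le lzP.
    by have := mZxi j measurableT _ mS; rewrite setTI.
  have m_good : measurable good.
    rewrite (_ : good = \bigcup_j
       ((stops j `&` \bigcap_(i in [set i | (i < j)%N]) ~` stops i) `&`
        Z j.+1 @^-1` [set x : X |
          - 2 * Num.max eps2 eps1 <= lambda_min (hess f x)])).
      apply: bigcupT_measurable => j; apply: measurableI.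
        apply: measurableI => //; apply: bigcap_measurableType => i _.
        exact: measurableC.
      rewrite -[X in measurable X]setTI; apply: mZ => //.
      exact: (measurable_curvature d_gt0 f2 (ltW L2_gt0) hessL _).
    apply/seteqP; split=> o /=.
      move=> [[|j] [[] // _ ex st] hl]; exists j => //; split=> //.
      split=> // i /= ij.
      by apply: ex.
    move=> [j _ [[st ex] hl]]; exists j.+1 => //; split=> //; split=> // -[//|i] ij.
    exact: ex.
  split=> //.
  (* Union bound over the iterations 1, ..., truncn K, shifted to start at 0. *)
  pose bad k := [set o | lanczos_failure f H lz eps2 delta1 (Z k.+1 o, xi k.+1 o)].
  have mF : measurable (lanczos_failure f H lz eps2 delta1).
    exact: (measurable_lanczos_failure d_gt0 eps2_gt0 delta1_01 f2 mH
      H_sym H_le lzP).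
  have m_bad k : measurable (bad k).
    by have := mZxi k measurableT _ mF; rewrite setTI.
  have P_bad k : (P (bad k) <= delta1%:E)%E.
    pose Zk : {mfun Omega >-> X} := mfun_Sub (mem_set (mZ k)).
    apply: (@fresh_seed_bound _ _ _ _ _ _ _ P mu Zk (xi k.+1)) => //; last first.
      move=> x; exact: (lanczos_failure_le d_gt0 eps2_gt0 delta1_01 f2 mH
        H_sym H_le lzP x).
    move=> E B mE mB.
    have := chain_independent mPhi Z1 ZS xi_indep mE
      (J := [:: k.+1]) (A := fun=> B) isT _ (fun=> mB) (j := k).
    rewrite set_cons1 bigcap_set1 big_seq1 => ->; last first.
      by move=> i; rewrite inE => /eqP ->.
    by congr (_ * _)%E; exact: xi_law.
  pose N := Num.truncn K.
  have bad_cover : ~` good `<=` \big[setU/set0]_(k < N) bad k.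
    move=> o /= ngood; rewrite -bigcup_mkord.
    have [j hj] := halting (run o).
    have jK : j%:R <= K by case: hj => ex _; exact: exec_le ex.
    case: j hj jK => [[[]]//|k] hj jK.
    exists k => /=; first by rewrite /N truncn_ge_nat// ltW.
    move=> ok; apply: ngood; exists k.+1 => //.
    have [_ [hq hg]] := hj.
    exact: (curvature_guarantee d_gt0 eps2_gt0 eps3_le H_approx H_sym hess_symm
      hq hg ok).
  have P_ngood : (P (~` good) <= delta%:E)%E.
    have mU : measurable (\big[setU/set0]_(k < N) bad k).
      by apply: bigsetU_measurable.
    apply: (@le_trans _ _ (P (\big[setU/set0]_(k < N) bad k))).
      by apply: le_measure; rewrite ?inE//; exact: measurableC.
    apply: le_trans (Boole_inequality _ _) _ => //.
    apply: (@le_trans _ _ (\sum_(k < N) delta1%:E)%E).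
      by apply: lee_sum => k _; exact: P_bad.
    rewrite sumEFin lee_fin sumr_const card_ord -mulr_natl.
    have NK : N%:R <= K by rewrite truncn_le ltW.
    apply: le_trans (ler_wpM2r _ NK) _; first by case/andP: delta1_01 => /ltW.
    by rewrite /delta1 mulrCA divff ?mulr1// gt_eqF.
  have := P_ngood; rewrite probability_setC//.
  have := fin_num_measure P _ m_good; case: (P good) => [r|//|//] _.
    by rewrite -EFinB !lee_fin; lra.
  by rewrite leey.
- move=> omega j _; rewrite /iteration_time.
  have := lz_cost lzP (run omega j) (input (x_ (run omega) j)) delta1_01.
  set n := lz_products _ _ _ _ _; set m := Num.max _ _; set l := ln _ => cost.
  have m_gt0 : 0 < m by rewrite lt_max eps2_gt0.
  apply: le_trans (ler_wpM2l Th_ge0 cost) _.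
  rewrite le_eqVlt; apply/orP; left; apply/eqP.
  rewrite /lanczos_eps -/m sqrtrM ?(ltW m_gt0)// sqrtrV//.
  by field; rewrite !gt_eqF ?sqrtr_gt0.
Qed.
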